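(* For each $n\in\mathbb{N}$ let $\xi_{ni}$, $i\in\mathbb{N}$, be independent identically distributed real random variables, and let $\xi_i$, $i\in\mathbb{N}$, be independent identically distributed real random variables. Let $\pi(t)$, $t\ge 0$, be a Poisson random process with intensity $1$, independent of $(\xi_{ni})_{i}$ for each $n$ and independent of $(\xi_i)_i$. Put $$V_n'(t)=\sum_{i=1}^{\pi(t)}\xi_{ni},\qquad V'(t)=\sum_{i=1}^{\pi(t)}\xi_i,\qquad t\in[0,1].$$ Suppose that $\xi_{ni}\xrightarrow{d}\xi_i$ as $n\to\infty$. Then $V_n'\xrightarrow{d}V'$ as $n\to\infty$ in $D[0,1]$.
   Context: $D[0,1]$ is the Skorohod space with its usual (Skorohod) metric; processes with trajectories in $D[0,1]$ are identified with the corresponding random elements; $\xrightarrow{d}$ denotes convergence in distribution. An empty sum is $0$. *)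

(* Defs.v *)
From HB Require Import structures.
From mathcomp Require Import all_boot all_order all_algebra.
From mathcomp Require Import all_classical all_reals all_analysis.
From mathcomp Require Import lra.

Set Implicit Arguments.
Unset Strict Implicit.
Unset Printing Implicit Defensive.

Import Order.TTheory GRing.Theory Num.Theory.
Import numFieldNormedType.Exports.

Local Open Scope classical_set_scope.
Local Open Scope ring_scope.

Definition I01 (R : realType) : set R := `[0, 1]%classic.
Arguments I01 R : clear implicits.

Section cadlag.
Context {R : realType}.

(* Right continuity with left limits, for [f] defined on the subspace [A] of
   the line.  A one-sided filter that is trivial (e.g. at an endpoint of an
   interval) imposes no condition. *)
Definition cadlag (A : set R) (S : topologicalType) (f : A -> S) : Prop :=
  forall t : A,
    f @ within [set s : A | set_val t < set_val s] (nbhs t) --> f t /\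
    exists l : S, f @ within [set s : A | set_val s < set_val t] (nbhs t) --> l.

Lemma cadlag_comp (A : set R) (S S' : topologicalType) (f : A -> S)
  (g : S -> S') : continuous g -> cadlag f -> cadlag (g \o f).
Proof.
move=> cg cf t; have [fr [l fl]] := cf t; split.
  exact: (cvg_comp _ _ fr (cg _)).
by exists (g l); exact: (cvg_comp _ _ fl (cg _)).
Qed.

Lemma set_type_nbhsP (A : set R) (t : A) (U : set A) :
  nbhs t U <-> exists2 e : R, 0 < e &
    forall s : A, `|set_val t - set_val s| < e -> U s.
Proof.
split.
  move=> [V [[W oW WV] Vt] VU].
  have Wt : W (set_val t) by move: Vt; rewrite -WV.
  have /nbhs_ballP[e e0 eW] := open_nbhs_nbhs (conj oW Wt).
  exists e => // s ts; apply: VU; rewrite -WV /=; apply: eW; exact: ts.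
move=> [e e0 eU].
have : nbhs t [set s : A | ball (set_val t) e (set_val s)].
  apply: (@initial_continuous A R set_val t); exact: nbhsx_ballx.
by apply: filterS => s; exact: eU.
Qed.

End cadlag.

Definition set_widen (R : realType) (A B : set R) (AB : A `<=` B) (t : A) : B :=
  exist _ (set_val t) (mem_set (AB _ (set_mem (valP t)))).

Lemma cadlag_restrict (R : realType) (A B : set R) (AB : A `<=` B)
  (S : topologicalType) (f : R -> S) :
  cadlag (fun t : B => f (set_val t)) -> cadlag (fun t : A => f (set_val t)).
Proof.
move=> cf t; have [fr [l fl]] := cf (set_widen AB t); split; last exists l.
- move=> U /fr /= /set_type_nbhsP[e e0 eU]; apply/set_type_nbhsP.
  by exists e => // s ts /= st; exact: (eU (set_widen AB s)).
- move=> U /fl /= /set_type_nbhsP[e e0 eU]; apply/set_type_nbhsP.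
  by exists e => // s ts /= st; exact: (eU (set_widen AB s)).
Qed.

Record skorohod (R : realType) := Skorohod {
  skorohod_fun :> I01 R -> R ;
  skorohod_cadlag : cadlag skorohod_fun }.

HB.instance Definition _ (R : realType) := gen_eqMixin (skorohod R).
HB.instance Definition _ (R : realType) := gen_choiceMixin (skorohod R).

Section skorohod_metric.
Context {R : realType}.
Implicit Types (x y z : skorohod R) (t s : I01 R).

Definition time_change (lam : I01 R -> I01 R) : Prop :=
  [/\ continuous lam,
      forall s t, set_val s < set_val t -> set_val (lam s) < set_val (lam t)
    & range lam = setT].

Definition skorohod_close x y : set R :=
  [set e | exists2 lam, time_change lam & forall t,
     `|set_val (lam t) - set_val t| <= e /\ `|x t - y (lam t)| <= e].

(* The infimum over the time changes [lam] of
   max (sup_t |lam t - t|, sup_t |x t - y (lam t)|). *)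
Definition skorohod_dist x y : R := inf (skorohod_close x y).

Lemma I01_inj s t : set_val s = set_val t -> s = t.
Proof. by move=> st; apply/val_inj; move: st; rewrite set_valE. Qed.

Lemma I01_ge0 t : 0 <= set_val t.
Proof. by have := set_mem (valP t); rewrite /I01 /= in_itv /= => /andP[]. Qed.

Lemma I01_le1 t : set_val t <= 1.
Proof. by have := set_mem (valP t); rewrite /I01 /= in_itv /= => /andP[]. Qed.

Lemma I01_ex (r : R) : 0 <= r -> r <= 1 -> exists t, set_val t = r.
Proof.
move=> r0 r1; have rI : r \in I01 R by rewrite inE /I01 /= in_itv /= r0.
by exists (exist _ r rI).
Qed.

Lemma increasing_surj_continuous (lam : I01 R -> I01 R) :
  (forall s t, set_val s < set_val t -> set_val (lam s) < set_val (lam t)) ->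
  range lam = setT -> continuous lam.
Proof.
move=> hlam slam t U /= /set_type_nbhsP[e e0 eU].
have lamS u : exists v, lam v = u.
  have : range lam u by rewrite slam.
  by move=> [v _ <-]; exists v.
have lo : nbhs t [set s | set_val (lam t) - e < set_val (lam s)].
  have [h|h] := ltP (set_val (lam t) - e / 2) 0.
    apply/set_type_nbhsP; exists 1 => //= s _.
    by have := I01_ge0 (lam s); lra.
  have [|a av] := I01_ex h; first by have := I01_le1 (lam t); lra.
  have [a' a'E] := lamS a.
  have a't : set_val a' < set_val t.
    rewrite ltNge le_eqVlt; apply/negP => /orP[/eqP/I01_inj ta|/hlam].
      by move: av; rewrite -a'E -ta; lra.
    by rewrite a'E av; lra.
  apply/set_type_nbhsP; exists (set_val t - set_val a'); rewrite ?subr_gt0//.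
  move=> s; rewrite ltr_norml => /andP[_]; rewrite ltrD2l ltrN2 => /hlam.
  by rewrite a'E av /=; lra.
have hi : nbhs t [set s | set_val (lam s) < set_val (lam t) + e].
  have [h|h] := ltP 1 (set_val (lam t) + e / 2).
    apply/set_type_nbhsP; exists 1 => //= s _.
    by have := I01_le1 (lam s); lra.
  have [|a av] := I01_ex _ h; first by have := I01_ge0 (lam t); lra.
  have [a' a'E] := lamS a.
  have a't : set_val t < set_val a'.
    rewrite ltNge le_eqVlt; apply/negP => /orP[/eqP/I01_inj ta|/hlam].
      by move: av; rewrite -a'E ta; lra.
    by rewrite a'E av; lra.
  apply/set_type_nbhsP; exists (set_val a' - set_val t); rewrite ?subr_gt0//.
  move=> s; rewrite distrC ltr_norml => /andP[_]; rewrite ltrD2r => /hlam.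
  by rewrite a'E av /=; lra.
apply: filterS2 lo hi => s /= s1 s2; apply: eU.
by rewrite distrC ltr_distl s1.
Qed.

Lemma time_change_id : time_change id.
Proof.
by split => //; [move=> t; exact: cvg_id|rewrite image_id].
Qed.

Lemma time_change_comp (lam mu : I01 R -> I01 R) :
  time_change lam -> time_change mu -> time_change (mu \o lam).
Proof.
move=> [cl hl sl] [cm hm sm]; split.
- by move=> t; apply: continuous_comp; [exact: cl|exact: cm].
- by move=> s t st; apply/hm/hl.
- rewrite -subTset => u _.
  have [v _ <-] : range mu u by rewrite sm.
  have [w _ <-] : range lam v by rewrite sl.
  by exists w.
Qed.

Lemma time_change_inj (lam : I01 R -> I01 R) : time_change lam -> injective lam.
Proof.
move=> [_ h _] s t st; apply: I01_inj.
by have [/h|/h|//] := ltgtP (set_val s) (set_val t); rewrite st ltxx.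
Qed.

Lemma time_change_inv (lam : I01 R -> I01 R) : time_change lam ->
  exists mu, [/\ time_change mu, cancel mu lam & cancel lam mu].
Proof.
move=> tl; have [_ h sl] := tl.
have lamS u : {v | lam v = u}.
  apply: cid; have : range lam u by rewrite sl.
  by move=> [v _ <-]; exists v.
pose mu u := sval (lamS u).
have muK : cancel mu lam by move=> u; rewrite /mu; case: (lamS u).
have lamK : cancel lam mu by move=> u; apply: (time_change_inj tl); rewrite muK.
exists mu; split => //.
have hm s t : set_val s < set_val t -> set_val (mu s) < set_val (mu t).
  rewrite -{1}(muK s) -{1}(muK t) => st.
  have [//|/h|/I01_inj e] := ltgtP (set_val (mu s)) (set_val (mu t)).
    by move/(lt_trans st); rewrite ltxx.
  by move: st; rewrite e ltxx.
have sm : range mu = setT.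
  by rewrite -subTset => u _; exists (lam u).
by split => //; exact: increasing_surj_continuous.
Qed.

Lemma skorohod_bounded x : exists M, forall t, `|x t| <= M.
Proof.
pose P (M r : R) := forall t, set_val t = r -> `|x t| <= M.
have /compact_near_coveringP := @segment_compact R 0 1.
move=> /(_ R (+oo)%R P _)[].
  move=> r /=; rewrite in_itv /= => /andP[r0 r1].
  have [t tr] := I01_ex r0 r1.
  have [xr [l xl]] := skorohod_cadlag x t.
  have /set_type_nbhsP[e1 e10 h1] : nbhs t [set s | set_val t < set_val s ->
    `|x t - x s| < 1] by move/cvgrPdist_lt : xr; exact.
  have /set_type_nbhsP[e2 e20 h2] : nbhs t [set s | set_val s < set_val t ->
    `|l - x s| < 1] by move/cvgrPdist_lt : xl; exact.
  exists (ball r (Num.min e1 e2), [set M | `|x t| + `|l| + 1 <= M]).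
    split; first by apply: nbhsx_ballx; rewrite lt_min e10.
    exact: nbhs_pinfty_ge.
  move=> [r' M] /= [rr' hM] s sr'; apply: le_trans hM.
  move: rr'; rewrite /ball /= -tr -sr' lt_min => /andP[s1 s2].
  have [st|st|/I01_inj ->] := ltgtP (set_val s) (set_val t).
  - have := h2 _ s2 st; rewrite distrC => /ltW xs.
    rewrite -[X in `|X|](subrK l) (le_trans (ler_normD _ _))//.
    by have := normr_ge0 (x t); lra.
  - have := h1 _ s1 st; rewrite distrC => /ltW xs.
    rewrite -[X in `|X|](subrK (x t)) (le_trans (ler_normD _ _))//.
    by have := normr_ge0 l; lra.
  - by rewrite -addrA lerDl addr_ge0.
move=> M [_ HM]; exists (M + 1) => t; apply: (HM (M + 1)) => //.
  by rewrite ltrDl.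
by rewrite /= in_itv /= I01_ge0 I01_le1.
Qed.

Lemma skorohod_close_ge0 x y : lbound (skorohod_close x y) 0.
Proof.
move=> e [lam _ h]; have [||t _] := @I01_ex 0 => //.
by have [+ _] := h t; exact: le_trans.
Qed.

Lemma skorohod_close_nonempty x y : skorohod_close x y !=set0.
Proof.
have [M HM] := skorohod_bounded x; have [N HN] := skorohod_bounded y.
exists (M + N); exists id; first exact: time_change_id.
move=> t; split; last first.
  by rewrite (le_trans (ler_normB _ _))// lerD.
by rewrite subrr normr0 addr_ge0// (le_trans _ (HM t), le_trans _ (HN t)).
Qed.

Lemma skorohod_has_inf x y : has_inf (skorohod_close x y).
Proof.
split; first exact: skorohod_close_nonempty.
by exists 0; exact: skorohod_close_ge0.
Qed.

Lemma skorohod_dist_le x y e : skorohod_close x y e -> skorohod_dist x y <= e.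
Proof.
by move=> h; apply: ge_inf => //; exists 0; exact: skorohod_close_ge0.
Qed.

Lemma skorohod_dist_ge0 x y : 0 <= skorohod_dist x y.
Proof.
apply: lb_le_inf; first exact: skorohod_close_nonempty.
exact: skorohod_close_ge0.
Qed.

Lemma skorohod_distxx x : skorohod_dist x x = 0.
Proof.
apply/eqP; rewrite eq_le skorohod_dist_ge0 andbT; apply: skorohod_dist_le.
exists id; first exact: time_change_id.
by move=> t; rewrite !subrr normr0.
Qed.

Lemma skorohod_dist_sym x y : skorohod_dist x y = skorohod_dist y x.
Proof.
suff H a b : skorohod_close a b `<=` skorohod_close b a.
  by congr inf; apply/seteqP; split; exact: H.
move=> e [lam /time_change_inv[mu [tmu muK lamK]] h]; exists mu => // t.
have [h1 h2] := h (mu t); rewrite muK in h1 h2.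
by split; rewrite distrC.
Qed.

Lemma skorohod_dist_triangle y x z :
  skorohod_dist x z <= skorohod_dist x y + skorohod_dist y z.
Proof.
rewrite -lerBlDl; apply: lb_le_inf; first exact: skorohod_close_nonempty.
move=> e2 [mu tmu hmu]; rewrite lerBlDl -lerBlDr.
apply: lb_le_inf; first exact: skorohod_close_nonempty.
move=> e1 [lam tlam hlam]; rewrite lerBlDr.
apply: skorohod_dist_le; exists (mu \o lam); first exact: time_change_comp.
move=> t; have [m1 m2] := hmu (lam t); have [l1 l2] := hlam t; split => /=.
  rewrite -(subrKA (set_val (lam t))) (le_trans (ler_normD _ _))//.
  by rewrite addrC lerD.
by rewrite -(subrKA (y (lam t))) (le_trans (ler_normD _ _))// lerD.
Qed.

Lemma skorohod_dist_eq0 x y : skorohod_dist x y = 0 -> x = y.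
Proof.
move=> d0.
have H e : 0 < e -> exists2 lam, time_change lam & forall t,
     `|set_val (lam t) - set_val t| <= e /\ `|x t - y (lam t)| <= e.
  move=> e0; have [e' [lam tlam h]] := inf_adherent e0 (skorohod_has_inf x y).
  rewrite -/(skorohod_dist x y) d0 add0r => /ltW e'e.
  by exists lam => // t; have [h1 h2] := h t; split; exact: le_trans e'e.
suff xy : skorohod_fun x = skorohod_fun y.
  by case: x y xy {d0 H} => [f cf] [g cg] /= fg; subst g; congr Skorohod;
     exact: Prop_irrelevance.
apply/funext => t; apply/eqP; rewrite -subr_eq0 -normr_eq0 eq_le normr_ge0 andbT.
rewrite leNgt; apply/negP => xyt; set D := `|_| in xyt.
have [t1|t1] := leP 1 (set_val t).
  have {}t1 : set_val t = 1 by apply/eqP; rewrite eq_le t1 I01_le1.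
  have D2 : 0 < D / 2 by rewrite divr_gt0.
  have [lam [_ hl sl] /(_ t)[_]] := H _ D2.
  suff -> : lam t = t.
    by apply/negP; rewrite -ltNge -/D ltr_pdivrMr// ltr_pMr// ltr1n.
  have [u _ ut] : range lam t by rewrite sl.
  have [/I01_inj ut'|ut'] := eqVneq (set_val u) (set_val t).
    by rewrite -{1}ut' ut.
  have /hl : set_val u < set_val t by rewrite lt_neqAle ut' t1 I01_le1.
  by rewrite ut t1 ltNge I01_le1.
have D4 : 0 < D / 4 by rewrite divr_gt0.
have [xr _] := skorohod_cadlag x t; have [yr _] := skorohod_cadlag y t.
have /set_type_nbhsP[e1 e10 h1] : nbhs t [set s | set_val t < set_val s ->
  `|x t - x s| < D / 4] by move/cvgrPdist_lt : xr; exact.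
have /set_type_nbhsP[e2 e20 h2] : nbhs t [set s | set_val t < set_val s ->
  `|y t - y s| < D / 4] by move/cvgrPdist_lt : yr; exact.
pose eta := Num.min (Num.min e1 e2) (1 - set_val t) / 2.
have eta0 : 0 < eta by rewrite divr_gt0// !lt_min e10 e20 subr_gt0.
have eta1 : eta * 2 <= e1 by rewrite divfK// !ge_min lexx.
have eta2 : eta * 2 <= e2 by rewrite divfK// !ge_min lexx orbT.
have eta3 : eta * 2 <= 1 - set_val t by rewrite divfK// !ge_min lexx !orbT.
have t0 := I01_ge0 t.
have [||s sE] := @I01_ex (set_val t + eta); [lra|lra|].
pose del := Num.min (eta / 2) (D / 4).
have del0 : 0 < del by rewrite lt_min D4 divr_gt0.
have [lam _ /(_ s)[]] := H _ del0.
rewrite le_min => /andP[+ _]; rewrite le_min => + /andP[_ k2].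
rewrite ler_norml => /andP[k3 k4].
have a1 : `|x t - x s| < D / 4.
  by apply: h1; [rewrite sE opprD addNKr normrN gtr0_norm//; lra | lra].
have a2 : `|y t - y (lam s)| < D / 4.
  by apply: h2; [rewrite ltr_norml; apply/andP; split; lra | lra].
have : D <= `|x t - x s| + `|x s - y (lam s)| + `|y (lam s) - y t|.
  by rewrite /D -(subrKA (y (lam s)) (x t)) (le_trans (ler_normD _ _))// lerD2r
    -(subrKA (x s)) (le_trans (ler_normD _ _)).
rewrite (distrC (y (lam s))); lra.
Qed.

End skorohod_metric.

HB.instance Definition _ (R : realType) := @isMetric.Build R (skorohod R)
  skorohod_dist skorohod_distxx skorohod_dist_eq0 skorohod_dist_sym
  skorohod_dist_triangle.

Section probability_notions.
Context {d : measure_display} {T : measurableType d} {R : realType}.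
Context (P : probability T R).

Definition mutually_independent (I : choiceType) (X : I -> T -> R) : Prop :=
  forall (J : seq I) (B : I -> set R), uniq J -> (forall i, measurable (B i)) ->
  (P (\bigcap_(i in [set` J]) X i @^-1` B i) =
   \prod_(i <- J) P (X i @^-1` B i))%E.

Definition identically_distributed (I : Type) (X : I -> T -> R) : Prop :=
  forall i j (B : set R), measurable B -> P (X i @^-1` B) = P (X j @^-1` B).

Definition iid (I : choiceType) (X : I -> {RV P >-> R}) : Prop :=
  mutually_independent X /\ identically_distributed X.

(* The sigma-algebra on [T] generated by the variables [X i], [i] in [D]. *)
Definition sigma_generated (I : Type) d' (S : measurableType d') (D : set I)
    (X : I -> T -> S) : set (set T) :=
  <<s \bigcup_(i in D) preimage_set_system setT (X i) measurable >>.

Definition independent_classes (F G : set (set T)) : Prop :=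
  forall A B, F A -> G B -> P (A `&` B) = (P A * P B)%E.

(* The paths are only required to be cadlag and N-valued; that they are almost
   surely nondecreasing follows from the laws of the increments. *)
Record poisson_process (lambda : R) (N : R -> T -> nat) : Prop :=
  PoissonProcess {
  poisson_measurable : forall t : R, 0 <= t -> measurable_fun setT (N t) ;
  poisson_cadlag : forall w,
    cadlag (fun t : (`[0, +oo[%classic : set R) => N (set_val t) w) ;
  poisson_start : P [set w | N 0 w = 0%N] = 1%E ;
  poisson_increments : forall (s t : R) (k : nat), 0 <= s -> s < t ->
    P [set w | N t w = (N s w + k)%N] =
      (poisson_pmf (lambda * (t - s)) k)%:E ;
  poisson_independent : forall u : nat -> R,
    0 <= u 0%N -> {homo u : i j / (i <= j)%N >-> i <= j} ->
    mutually_independent (fun j w => (N (u j.+1) w)%:R - (N (u j) w)%:R) }.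

Definition borel_random_element (S : topologicalType) (X : T -> S) : Prop :=
  forall B, <<s [set U : set S | open U] >> B -> measurable (X @^-1` B).

Definition cvg_in_distribution (S : topologicalType) (X : nat -> T -> S)
    (Y : T -> S) : Prop :=
  [/\ forall n, borel_random_element (X n), borel_random_element Y
    & forall h : S -> R, continuous h -> (exists M : R, forall x, `|h x| <= M) ->
      ('E_P[h \o X n] @[n --> \oo] --> 'E_P[h \o Y])%E ].

End probability_notions.

Lemma I01_sub_nonneg (R : realType) : I01 R `<=` `[0, +oo[%classic.
Proof. by move=> r; rewrite /I01 /= !in_itv /= andbT => /andP[]. Qed.

Lemma cadlag_compound (R : realType) (N : R -> nat) (x : nat -> R) :
  cadlag (fun t : (`[0, +oo[%classic : set R) => N (set_val t)) ->
  cadlag (fun t : I01 R => \sum_(i < N (set_val t)) x i).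
Proof.
move=> cN; apply: (@cadlag_comp _ _ _ _ _ (fun n => \sum_(i < n) x i)).
  by move=> n U /nbhs_singleton Un; rewrite nbhs_simpl /= nbhs_principalE => k ->.
exact: (cadlag_restrict (@I01_sub_nonneg R)).
Qed.

(* The path t |-> x_1 + ... + x_{N(t)}, with the summands indexed from 0. *)
Definition compound_path (R : realType) (N : R -> nat)
    (cN : cadlag (fun t : (`[0, +oo[%classic : set R) => N (set_val t)))
    (x : nat -> R) : skorohod R :=
  Skorohod (cadlag_compound x cN).
Arguments compound_path {R} N cN x.

(* Main.v *)
Require Import Defs.
From mathcomp Require Import all_boot all_order all_algebra.
From mathcomp Require Import all_classical all_reals all_analysis.
From mathcomp Require Import measurable_realfun ring lra.

Set Implicit Arguments.
Unset Strict Implicit.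
Unset Printing Implicit Defensive.

Import Order.TTheory GRing.Theory Num.Theory.
Import numFieldNormedType.Exports.

Local Open Scope classical_set_scope.
Local Open Scope ring_scope.

(** Condition on the Poisson process: for a fixed piecewise constant path, the
compound path is a Lipschitz function of finitely many of the summands, and
finitely many independent coordinates converge jointly in distribution as soon
as each of them does.  The proof avoids conditional laws by reducing to events
of the form: the jump process, read off on a finite time grid, has a given
finite code.

- It suffices to test with bounded Lipschitz functionals [h] of the path
  ([borel_from_lipschitz], [cvg_in_distribution_lipschitz]): a bounded
  continuous function is the increasing limit of its Lipschitz envelopes
  [inf_y (h y + k d(x, y))], and the limit inferior of expectations is
  controlled by each of them; apply this to [h] and to [- h].

- Sampling the jump process on the grid of mesh [1 / (m + 1)] and truncating its
  values at [m] moves the compound path by at most [C / (m + 1)] in the Skorohod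
  metric once [m] is large, where [C] and the meaning of large depend on the
  path of the jump process only and not on the summands ([sampled_path_dist]).  The reason is that a small time change
  carries every jump to the next grid point ([grid_sampling]), after which the
  two jump processes coincide exactly; equal jump processes give equal compound
  paths, however large the summands are.

- A sampled process takes finitely many codes, each on an event [A] determined
  by the jump process.  Given the code, [h] of the compound path is a bounded
  Lipschitz function [F] of the first [m] summands.  Such an [F] is approximated
  by finite sums of products of one-variable bumps, up to an error that is
  itself a product expectation ([bump_approx_dist]).  Independence turns the
  expectation of [1_A] times a product into a product of expectations
  ([Ex_prod]), to which the convergence of each single summand applies; hence
  [E[1_A F]] converges ([finite_dim_cvg]).

- The error of sampling is uniform in the index [n] of the sequence, since [C]
  above does not see the summands; so the limits in [n] and in the mesh may be
  exchanged ([double_limit], [compound_process_cvg]). *)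

(** * Integer-valued cadlag paths and their sampling on a grid *)

Section step_paths.
Context {R : realType}.
Implicit Types (p : R -> nat) (s : seq R) (t u : R).

Lemma nat_cvg_near (T : Type) (F : set_system T) (f : T -> nat) k :
  f @ F --> k -> F [set x | f x = k].
Proof.
move=> /(_ [set k])/=; apply.
by rewrite nbhs_principalE => l ->.
Qed.

(** In the discrete topology of [nat], one-sided limits are eventually attained;
the left end [t - e] is included since [breakpoints] can only ensure
[t - e <= b]. *)
Lemma locally_constant p t : cadlag (fun u : I01 R => p (set_val u)) ->
  exists2 e, 0 < e & forall a b, 0 <= a <= 1 -> 0 <= b <= 1 ->
    (t - e <= a < t -> t - e <= b < t -> p a = p b) /\
    (t <= a < t + e -> t <= b < t + e -> p a = p b).
Proof.
move=> cp; have [t01|t01] := boolP (0 <= t <= 1); last first.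
  have [t0|t0] := ltP t 0.
    by exists (- t); [lra|move=> a b *; split=> *; exfalso; lra].
  by move: t01; rewrite t0 -ltNge /= => t1; exists ((t - 1) / 2);
    [lra|move=> a b *; split=> *; exfalso; lra].
have /andP[t0 t1] := t01; have [v vt] := I01_ex t0 t1.
have [vr [l vl]] := cp v.
have /set_type_nbhsP[e1 e10 h1] := nat_cvg_near vr.
have /set_type_nbhsP[e2 e20 h2] := nat_cvg_near vl.
pose e := Num.min e1 e2 / 2.
have e0 : 0 < e by rewrite divr_gt0// lt_min e10.
have ee1 : e < e1 by rewrite ltr_pdivrMr//; have : Num.min e1 e2 <= e1;
  [rewrite ge_min lexx|lra].
have ee2 : e < e2 by rewrite ltr_pdivrMr//; have : Num.min e1 e2 <= e2;
  [rewrite ge_min lexx orbT|lra].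
exists e => //.
have left a : 0 <= a <= 1 -> t - e <= a < t -> p a = l.
  move=> /andP[a0 a1] /andP[ta at_]; have [w wa] := I01_ex a0 a1.
  by rewrite -wa; apply: (h2 w); rewrite /= wa vt ?ger0_norm//; lra.
have right a : 0 <= a <= 1 -> t <= a < t + e -> p a = p t.
  move=> /andP[a0 a1] /andP[ta at_]; have [w wa] := I01_ex a0 a1.
  have [->//|nta] := eqVneq a t.
  have lta : t < a by rewrite lt_neqAle eq_sym nta.
  by rewrite -wa -vt; apply: (h1 w); rewrite /= wa vt// distrC ger0_norm//; lra.
move=> a b a01 b01; split => ha hb.
  by rewrite (left a)// (left b).
by rewrite (right a)// (right b).
Qed.

(** Compactness of the unit interval.  Saying that [a] and [b] lie above the
same points of [s] avoids sorting [s] and naming its cells. *)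
Lemma breakpoints p : cadlag (fun u : I01 R => p (set_val u)) ->
  exists s, forall a b, 0 <= a <= 1 -> 0 <= b <= 1 ->
    (forall u, u \in s -> (u <= a) = (u <= b)) -> p a = p b.
Proof.
move=> cp.
pose ec t := cid2 (locally_constant t cp).
pose e t := sval (ec t).
have e0 t : 0 < e t by rewrite /e; case: (ec t).
have he t a b : 0 <= a <= 1 -> 0 <= b <= 1 ->
    (t - e t <= a < t -> t - e t <= b < t -> p a = p b) /\
    (t <= a < t + e t -> t <= b < t + e t -> p a = p b).
  by rewrite /e; case: (ec t) => /= x _; exact.
have := @segment_compact R 0 1; rewrite compact_cover.
move=> /(_ R setT (fun t => ball t (e t)))[].
- by move=> t _; exact: ball_open.
- by move=> t _; exists t => //; exact: ballxx.
move=> D _ Dcov.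
(* the ends of the covering intervals keep [b] in the interval that contains
   [a], the centres keep it on the same side *)
exists (flatten [seq [:: t - e t; t; t + e t] | t <- finmap.enum_fset D]) => a b.
move=> a01 b01 hs.
have : `[0, 1]%classic a by rewrite /= in_itv.
move=> /Dcov[t /= tD]; rewrite /ball/= ltr_norml => /andP[ta1 ta2].
have hst u : u \in [:: t - e t; t; t + e t] -> (u <= a) = (u <= b).
  by move=> ut; apply: hs; apply/flatten_mapP; exists t.
have := hst (t - e t); rewrite inE eqxx => /(_ isT) h1.
have := hst t; rewrite !inE eqxx !orbT => /(_ isT) h2.
have := hst (t + e t); rewrite !inE eqxx !orbT => /(_ isT) h3.
have [l r] := he t _ _ a01 b01.
have b1 : t - e t <= b by rewrite -h1; lra.
have b2 : b < t + e t by rewrite ltNge -h3; rewrite -ltNge; lra.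
have [ta|ta] := leP t a.
  have tb : t <= b by rewrite -h2.
  by apply: r; apply/andP; split => //; lra.
have tb : b < t by rewrite ltNge -h2 -ltNge.
by apply: l; apply/andP; split => //; lra.
Qed.

Lemma pos_gap s : exists2 e, 0 < e &
  forall t u, t \in s -> u \in s -> t != u -> e <= `|t - u|.
Proof.
have pos_lb (l : seq R) : (forall x, x \in l -> 0 < x) ->
    exists2 e, 0 < e & forall x, x \in l -> e <= x.
  elim: l => [_|x l IH hl]; first by exists 1.
  have [y yl|e e0 he] := IH; first by apply: hl; rewrite inE yl orbT.
  exists (Num.min x e); first by rewrite lt_min e0 hl// mem_head.
  move=> y; rewrite inE => /predU1P[->|/he ey]; rewrite ge_min ?lexx//.
  by rewrite ey orbT.
have [x|e e0 he] := pos_lb [seq x <- [seq `|t - u| | t <- s, u <- s] | 0 < x].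
  by rewrite mem_filter => /andP[].
exists e => // t u ts us tu; apply: he; rewrite mem_filter normr_gt0 subr_eq0 tu.
by apply: allpairs_f.
Qed.

Definition hat (e u t : R) : R := Num.max 0 (1 - `|t - u| / e).

Lemma hat_ge0 e u t : 0 <= hat e u t. Proof. by rewrite le_max lexx. Qed.

Lemma hat_le1 e u t : 0 < e -> hat e u t <= 1.
Proof. by move=> e0; rewrite ge_max ler01 gerBl divr_ge0// ltW. Qed.

Lemma hat_center e u : hat e u u = 1.
Proof. by rewrite /hat subrr normr0 mul0r subr0 max_r. Qed.

Lemma hat_far e u t : 0 < e -> e <= `|t - u| -> hat e u t = 0.
Proof. by move=> e0 eut; rewrite /hat max_l// subr_le0 ler_pdivlMr// mul1r. Qed.

Lemma hat_lipschitz e u t t' : 0 < e ->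
  `|hat e u t - hat e u t'| <= `|t - t'| / e.
Proof.
move=> e0; rewrite ler_pdivlMr// -[X in _ * X](gtr0_norm e0) -normrM mulrBl.
have hatE x : hat e u x * e = Num.max 0 (e - `|x - u|).
  by rewrite /hat maxr_pMl ?ltW// mul0r mulrBl mul1r divfK// gt_eqF.
rewrite !hatE.
have h1 := ler_distD t' t u; have h2 := ler_distD t t' u.
rewrite (distrC t' t) in h2.
by rewrite ler_norml !maxEle; case: ifP; case: ifP; move=> *; apply/andP; split; lra.
Qed.

Lemma ler_sum_size (s : seq R) (F : R -> R) c : (forall u, F u <= c) ->
  \sum_(u <- s) F u <= (size s)%:R * c.
Proof.
move=> Fc; elim: s => [|u s IH]; first by rewrite big_nil mul0r.
by rewrite big_cons/= -natr1 mulrDl mul1r addrC lerD.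
Qed.

Definition grid_up m u : R := (Num.ceil (m.+1%:R * u))%:~R / m.+1%:R.

Lemma grid_up_itv m u : 0 <= grid_up m u - u <= m.+1%:R^-1.
Proof.
have m0 : 0 < m.+1%:R :> R by rewrite ltr0n.
have /andP[h1 h2] := ceil_itv (m.+1%:R * u).
rewrite intrB in h1.
rewrite /grid_up subr_ge0 lerBlDr -[X in _ + X](mulKf (lt0r_neq0 m0)).
rewrite -[X in X + _]mulr1 -mulrDr mulrC ler_pM2l ?invr_gt0//.
rewrite -[X in X <= _](mulKf (lt0r_neq0 m0)) ler_pM2l ?invr_gt0//.
by rewrite h2/=; move: h1; rewrite ltrBlDl => /ltW.
Qed.

(** A sum of hats rather than a piecewise linear interpolation of the break
points: no ordering of [s] is needed, and monotonicity follows from the crude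
Lipschitz bound [size s / ((m + 1) e) < 1]. *)
Definition warp e s m t : R := t + \sum_(u <- s) (grid_up m u - u) * hat e u t.

Lemma warp_dist e s m t : 0 < e -> `|warp e s m t - t| <= (size s)%:R / m.+1%:R.
Proof.
move=> e0; rewrite /warp addrC addKr (le_trans (ler_norm_sum _ _ _))//.
apply: ler_sum_size => u; have /andP[g0 g1] := grid_up_itv m u.
rewrite normrM ger0_norm// ger0_norm ?hat_ge0//.
by rewrite -[leRHS]mulr1 ler_pM ?hat_ge0// hat_le1.
Qed.

Lemma warp_increasing e s m t t' : 0 < e -> (size s)%:R < m.+1%:R * e ->
  t < t' -> warp e s m t < warp e s m t'.
Proof.
move=> e0 sme tt'; rewrite -subr_gt0 /warp opprD addrACA -sumrB.
set S := \sum_(_ <- _) _.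
have m0 : 0 < m.+1%:R :> R by rewrite ltr0n.
have hS : `|S| <= (size s)%:R * ((t' - t) / (m.+1%:R * e)).
  rewrite (le_trans (ler_norm_sum _ _ _))//.
  apply: ler_sum_size => u; have /andP[g0 g1] := grid_up_itv m u.
  rewrite -mulrBr normrM ger0_norm// invfM mulrCA ler_pM//.
  by rewrite (le_trans (hat_lipschitz _ _ _ e0))// gtr0_norm ?subr_gt0.
have : `|S| < t' - t.
  apply: (le_lt_trans hS); rewrite mulrA mulrAC gtr_pMl ?subr_gt0//.
  by rewrite ltr_pdivrMr ?mul1r// mulr_gt0.
by rewrite ltr_norml => /andP[]; lra.
Qed.

Lemma warp_nondecreasing e s m t t' : 0 < e -> (size s)%:R < m.+1%:R * e ->
  t <= t' -> warp e s m t <= warp e s m t'.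
Proof.
move=> e0 sme; rewrite le_eqVlt => /orP[/eqP->//|tt'].
by rewrite ltW// warp_increasing.
Qed.

(** At a break point all the other hats vanish, since break points are at least
[e] apart. *)
Lemma warp_break e s m t : 0 < e -> uniq s ->
  (forall u v, u \in s -> v \in s -> u != v -> e <= `|u - v|) ->
  t \in s -> warp e s m t = grid_up m t.
Proof.
move=> e0 us hs ts; rewrite /warp (bigD1_seq t)//= hat_center mulr1.
rewrite big_seq_cond big1 => [|u /andP[us' ut]].
  by rewrite addr0 addrC subrK.
by rewrite hat_far ?mulr0// hs// eq_sym.
Qed.

Lemma hat_continuous e u : 0 < e -> continuous (hat e u).
Proof.
move=> e0 t; apply/cvgrPdist_le => d d0; near=> t'.
apply: (le_trans (hat_lipschitz _ _ _ e0)); rewrite ler_pdivrMr//.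
near: t'; apply/nbhs_ballP; exists (d * e); first exact: mulr_gt0.
by move=> z /ltW.
Unshelve. all: by end_near. Qed.

Lemma warp_continuous e s m : 0 < e -> continuous (warp e s m).
Proof.
move=> e0 t; apply: cvgD; first exact: cvg_id.
apply: (@cvg_big _ _ _ _ predT); first exact: add_continuous.
by move=> u _; apply: cvgM; [exact: cvg_cst|exact: hat_continuous].
Qed.

(** The warped break points are grid points, so rounding the warped time down to
the grid does not cross any of them. *)
Lemma warp_grid e s m t u : 0 < e -> uniq s -> (size s)%:R < m.+1%:R * e ->
  (forall u v, u \in s -> v \in s -> u != v -> e <= `|u - v|) ->
  u \in s -> 0 <= warp e s m t ->
  (u <= t) = (u <= (Num.truncn (m.+1%:R * warp e s m t))%:R / m.+1%:R).
Proof.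
move=> e0 us sme hs us' w0.
have m0 : 0 < m.+1%:R :> R by rewrite ltr0n.
have gE : m.+1%:R * grid_up m u = (Num.ceil (m.+1%:R * u))%:~R.
  by rewrite /grid_up mulrC divfK// gt_eqF.
have fE : (Num.truncn (m.+1%:R * warp e s m t))%:R =
    (Num.floor (m.+1%:R * warp e s m t))%:~R :> R.
  have mw : 0 <= m.+1%:R * warp e s m t by rewrite mulr_ge0.
  rewrite truncn_floor mw -[in RHS](@gez0_abs (Num.floor _))//.
  by rewrite floor_ge_int.
rewrite ler_pdivlMr// fE mulrC.
have [ut|tu] := leP u t; apply/esym.
  have : warp e s m u <= warp e s m t by exact: warp_nondecreasing.
  rewrite (warp_break m e0 us hs us') -(ler_pM2l m0) gE -floor_ge_int => h.
  by rewrite (le_trans (ceil_ge _))// ler_int.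
have := warp_increasing e0 sme tu.
rewrite (warp_break m e0 us hs us') -(ltr_pM2l m0) gE -floor_lt_int => h.
by apply/negbTE; rewrite -ltNge -ceil_gt_int.
Qed.

(** The time change is [warp]; the break points are completed by 0 and 1, which
are grid points, so that it fixes the ends of the interval. *)
Lemma grid_sampling p : cadlag (fun t : I01 R => p (set_val t)) ->
  exists C : R, \forall m \near \oo, exists2 lam : I01 R -> I01 R,
    time_change lam & forall t : I01 R, `|set_val (lam t) - set_val t| <= C / m.+1%:R /\
     p (set_val t) =
     p ((Num.truncn (m.+1%:R * set_val (lam t)))%:R / m.+1%:R).
Proof.
move=> /breakpoints[s0 hs0]; pose s := undup [:: 0, 1 & s0].
have us : uniq s by exact: undup_uniq.
have hs a b : 0 <= a <= 1 -> 0 <= b <= 1 ->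
    (forall u, u \in s -> (u <= a) = (u <= b)) -> p a = p b.
  move=> a01 b01 h; apply: hs0 => // u us0; apply: h.
  by rewrite mem_undup !inE us0 !orbT.
have s0_ : 0 \in s by rewrite mem_undup !inE eqxx.
have s1_ : 1 \in s by rewrite mem_undup !inE eqxx orbT.
have [e e0 gap] := pos_gap s.
exists (size s)%:R; near=> m.
have m0 : 0 < m.+1%:R :> R by rewrite ltr0n.
have sme : (size s)%:R < m.+1%:R * e.
  rewrite -ltr_pdivrMr// (@lt_trans _ _ m%:R) ?ltr_nat//.
  by near: m; exact: nbhs_infty_gtr.
have w0 : warp e s m 0 = 0.
  by rewrite (warp_break m e0 us gap)// /grid_up mulr0 ceil0 mul0r.
have w1 : warp e s m 1 = 1.
  by rewrite (warp_break m e0 us gap)// /grid_up mulr1 -[_%:R]/(Posz m.+1)%:~R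
    intrKceil divff// gt_eqF.
have wI t : 0 <= t <= 1 -> warp e s m t \in I01 R.
  move=> /andP[t0 t1]; rewrite inE /I01 /= in_itv/= -[X in X <= _]w0.
  by rewrite -[X in _ && (_ <= X)]w1 !warp_nondecreasing.
have tI (t : I01 R) : 0 <= set_val t <= 1 by rewrite I01_ge0 I01_le1.
pose lam (t : I01 R) : I01 R := exist _ (warp e s m (set_val t)) (wI _ (tI t)).
have lam_inc (t t' : I01 R) : set_val t < set_val t' ->
    set_val (lam t) < set_val (lam t') by exact: warp_increasing.
have lam_surj : range lam = setT.
  rewrite -subTset => t _; have := tI t; rewrite -[X in X <= _ <= _]w0.
  rewrite -[X in _ <= _ <= X]w1 => wt.
  have [||x] := @IVT R (warp e s m) 0 1 (set_val t) ler01.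
  - by apply: continuous_subspaceT => x; exact: warp_continuous.
  - by rewrite w0 w1 min_l// max_r// -w0 -w1.
  rewrite in_itv/= => /andP[x0 x1] xt; have [y yx] := I01_ex x0 x1.
  by exists y => //; apply: I01_inj; rewrite -xt -yx.
exists lam; first by split => //; exact: increasing_surj_continuous.
move=> t; split; first exact: warp_dist.
have lt := tI (lam t); have /andP[l0 l1] := lt.
have ml0 : 0 <= m.+1%:R * set_val (lam t) by rewrite mulr_ge0.
apply: hs => //.
  rewrite divr_ge0//= ler_pdivrMr// mul1r.
  have /andP[+ _] := truncn_itv ml0; move=> /le_trans; apply.
  by rewrite -[leRHS]mulr1 ler_pM2l.
by move=> u us'; exact: warp_grid.
Unshelve. all: by end_near. Qed.

End step_paths.

Section grid_paths.
Context {R : realType}.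

Definition grid_fun m (q : nat -> nat) (t : R) : nat :=
  q (Num.truncn (m.+1%:R * t)).

Lemma grid_fun_cadlag m q :
  cadlag (fun t : (`[0, +oo[%classic : set R) => grid_fun m q (set_val t)).
Proof.
have m0 : 0 < m.+1%:R :> R by rewrite ltr0n.
have pos (t : `[0, +oo[%classic) : 0 <= m.+1%:R * set_val t :> R.
  rewrite mulr_ge0//; have := set_mem (valP t).
  by rewrite /= in_itv/= andbT.
have cst_cvg (t : `[0, +oo[%classic) (D : set `[0, +oo[%classic) k (e : R) :
    0 < e -> (forall s, `|set_val t - set_val s| < e -> D s ->
      Num.truncn (m.+1%:R * set_val s) = k) ->
    (fun t => grid_fun m q (set_val t)) @ within D (nbhs t) --> q k.
  move=> e0 h U /nbhs_singleton/= Uk; apply/set_type_nbhsP; exists e => // s ts Ds.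
  by rewrite /= /grid_fun (h s).
move=> t; split.
  have /andP[k1 k2] := truncn_itv (pos t).
  apply: (cst_cvg t _ _
    ((Num.truncn (m.+1%:R * set_val t)).+1%:R / m.+1%:R - set_val t)).
    by rewrite subr_gt0 ltr_pdivlMr// mulrC.
  move=> s; rewrite /= distrC => + ts; rewrite gtr0_norm ?subr_gt0// ltrD2r.
  rewrite ltr_pdivlMr// mulrC => st; apply: truncn_def; rewrite st andbT.
  by rewrite (le_trans k1)// ler_pM2l// ltW.
pose c := Num.ceil (m.+1%:R * set_val t).
have /andP[c1 c2] := ceil_itv (m.+1%:R * set_val t).
exists (q `|c - 1|%N).
apply: (cst_cvg t _ _ (set_val t - (c - 1)%:~R / m.+1%:R)).
  by rewrite subr_gt0 ltr_pdivrMr// mulrC.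
move=> s /[swap]/= st; rewrite gtr0_norm ?subr_gt0// ltrD2l ltrN2.
rewrite ltr_pdivrMr// mulrC => cs.
have sc : m.+1%:R * set_val s < c%:~R.
  by rewrite (lt_le_trans _ c2)// ltr_pM2l.
have c1ge : 0 <= c - 1.
  have := le_lt_trans (pos s) sc; rewrite ltr0z -[0]/(0%:Z).
  by rewrite subr_ge0 -gtz0_ge1.
apply: truncn_def; rewrite natr_absz ger0_norm// ltW//=.
by rewrite -[X in _ < X]natr1 natr_absz ger0_norm// intrB subrK.
Qed.

(** When a time change identifies the jump processes it identifies the compound
paths, whatever the summands are. *)
Lemma skorohod_dist_time_change (p q : R -> nat) cp cq x (lam : I01 R -> I01 R) e :
  time_change lam ->
  (forall t, `|set_val (lam t) - set_val t| <= e /\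
     p (set_val t) = q (set_val (lam t))) ->
  mdist (compound_path p cp x) (compound_path q cq x) <= e.
Proof.
move=> tl h; apply: skorohod_dist_le; exists lam => // t.
have [h1 h2] := h t; split => //=.
by rewrite h2 subrr normr0 (le_trans _ h1).
Qed.

Lemma skorohod_dist_summands (p : R -> nat) cp K (x y : nat -> R) :
  (forall t, (p t <= K)%N) ->
  mdist (compound_path p cp x) (compound_path p cp y) <=
  \sum_(i < K) `|x i - y i|.
Proof.
move=> pK; apply: skorohod_dist_le; exists id; first exact: time_change_id.
move=> t; split => /=; first by rewrite subrr normr0 sumr_ge0.
rewrite -sumrB (le_trans (ler_norm_sum _ _ _))//.
rewrite (big_ord_widen K (fun i => `|x i - y i|))// big_mkcond/=.
by apply: ler_sum => i _; case: ifP.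
Qed.

End grid_paths.

(** * Expectations of bounded measurable functions *)

Section bounded_expectation.
Context {d : measure_display} {T : measurableType d} {R : realType}.
Variable P : probability T R.
Implicit Types f g : T -> R.

Definition bounded_measurable f :=
  measurable_fun setT f /\ exists M, forall w, `|f w| <= M.

Lemma bounded_measurable_integrable f : bounded_measurable f ->
  P.-integrable setT (EFin \o f).
Proof.
move=> [mf [M fM]]; apply: measurable_bounded_integrable => //.
  by rewrite (le_lt_trans (probability_le1 P measurableT)) ?ltry.
exists `|M|; split; first exact: normr_real.
by move=> x Mx w _ /=; rewrite (le_trans (fM w))// (le_trans (ler_norm M))// ltW.
Qed.

Lemma bounded_measurable_cst c : bounded_measurable (fun=> c).
Proof. by split; [exact: measurable_cst|exists `|c|]. Qed.

Lemma bounded_measurableD f g : bounded_measurable f -> bounded_measurable g ->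
  bounded_measurable (fun w => f w + g w).
Proof.
move=> [mf [M fM]] [mg [N gN]]; split; first exact: measurable_funD.
by exists (M + N) => w; rewrite (le_trans (ler_normD _ _))// lerD.
Qed.

Lemma bounded_measurableM f g : bounded_measurable f -> bounded_measurable g ->
  bounded_measurable (fun w => f w * g w).
Proof.
move=> [mf [M fM]] [mg [N gN]]; split; first exact: measurable_funM.
by exists (M * N) => w; rewrite normrM ler_pM.
Qed.

Lemma bounded_measurableZ c f : bounded_measurable f ->
  bounded_measurable (fun w => c * f w).
Proof. by apply: bounded_measurableM; exact: bounded_measurable_cst. Qed.

Lemma bounded_measurableB f g : bounded_measurable f -> bounded_measurable g ->
  bounded_measurable (fun w => f w - g w).
Proof.
move=> mf mg; under eq_fun do rewrite -mulN1r.
exact/bounded_measurableD/bounded_measurableZ.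
Qed.

Lemma bounded_measurable_norm f : bounded_measurable f ->
  bounded_measurable (fun w => `|f w|).
Proof.
move=> [mf [M fM]]; split; first exact: measurableT_comp.
by exists M => w; rewrite normr_id.
Qed.

Lemma bounded_measurable_sum I (s : seq I) (F : I -> T -> R) :
  (forall i, bounded_measurable (F i)) ->
  bounded_measurable (fun w => \sum_(i <- s) F i w).
Proof.
move=> hF; elim: s => [|i s IH].
  by under eq_fun do rewrite big_nil; exact: bounded_measurable_cst.
by under eq_fun do rewrite big_cons; exact: bounded_measurableD.
Qed.

Lemma bounded_measurable_prod I (s : seq I) (F : I -> T -> R) :
  (forall i, bounded_measurable (F i)) ->
  bounded_measurable (fun w => \prod_(i <- s) F i w).
Proof.
move=> hF; elim: s => [|i s IH].
  by under eq_fun do rewrite big_nil; exact: bounded_measurable_cst.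
by under eq_fun do rewrite big_cons; exact: bounded_measurableM.
Qed.

Lemma bounded_measurable_indic A : measurable A -> bounded_measurable \1_A.
Proof.
move=> mA; split; first exact: measurable_indic.
by exists 1 => w; rewrite indicE; case: (_ \in _); rewrite ?normr1 ?normr0.
Qed.

Definition Ex f : R := \int[P]_w f w.

Lemma expectationE f : bounded_measurable f -> ('E_P[f] = (Ex f)%:E)%E.
Proof.
move=> bf; rewrite unlock /Ex /Rintegral fineK//.
exact/integrable_fin_num/bounded_measurable_integrable.
Qed.

Lemma ExD f g : bounded_measurable f -> bounded_measurable g ->
  Ex (fun w => f w + g w) = Ex f + Ex g.
Proof. by move=> ? ?; apply: RintegralD => //; exact: bounded_measurable_integrable. Qed.

Lemma ExB f g : bounded_measurable f -> bounded_measurable g ->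
  Ex (fun w => f w - g w) = Ex f - Ex g.
Proof. by move=> ? ?; apply: RintegralB => //; exact: bounded_measurable_integrable. Qed.

Lemma ExZ c f : bounded_measurable f -> Ex (fun w => c * f w) = c * Ex f.
Proof. by move=> ?; apply: RintegralZl => //; exact: bounded_measurable_integrable. Qed.

Lemma Ex_cst c : Ex (fun=> c) = c.
Proof.
have PT : fine (P setT) = 1 by rewrite [X in fine X](probability_setT P).
by rewrite /Ex (Rintegral_cst P measurableT c) PT mulr1.
Qed.

Lemma Ex_sum I (s : seq I) (F : I -> T -> R) :
  (forall i, bounded_measurable (F i)) ->
  Ex (fun w => \sum_(i <- s) F i w) = \sum_(i <- s) Ex (F i).
Proof.
move=> hF; elim: s => [|i s IH].
  by under eq_fun do rewrite big_nil; rewrite Ex_cst big_nil.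
under eq_fun do rewrite big_cons.
by rewrite ExD ?IH ?big_cons//; exact: bounded_measurable_sum.
Qed.

Lemma le_Ex f g : bounded_measurable f -> bounded_measurable g ->
  (forall w, f w <= g w) -> Ex f <= Ex g.
Proof. by move=> ? ? fg; apply: le_Rintegral => //; exact: bounded_measurable_integrable. Qed.

Lemma Ex_norm_le f g : bounded_measurable f -> bounded_measurable g ->
  (forall w, `|f w| <= g w) -> `|Ex f| <= Ex g.
Proof.
move=> bf bg fg; rewrite ler_norml; apply/andP; split.
  rewrite -mulN1r -ExZ//; apply: le_Ex => //; first exact: bounded_measurableZ.
  by move=> w; rewrite mulN1r; have := fg w; rewrite ler_norml => /andP[].
by apply: le_Ex => // w; have := fg w; rewrite ler_norml => /andP[].
Qed.

Lemma Ex_indic A : measurable A -> Ex \1_A = fine (P A).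
Proof. by move=> mA; rewrite /Ex /Rintegral integral_indic// setIT. Qed.

Lemma Ex_cvg M (F : nat -> T -> R) f : (forall n, measurable_fun setT (F n)) ->
  (forall n w, `|F n w| <= M) -> (forall w, F n w @[n --> \oo] --> f w) ->
  Ex (F n) @[n --> \oo] --> Ex f.
Proof.
move=> mF FM Ff; apply: fine_cvg.
have mf : measurable_fun setT f.
  exact: (measurable_realfun.measurable_fun_cvg (h := F)).
have bf : bounded_measurable f.
  split => //; exists M => w.
  have /cvg_norm nFf := Ff w; rewrite -(cvg_lim _ nFf)//.
  apply: limr_le; first by apply/cvg_ex; eexists; exact: nFf.
  by apply: nearW => n.
rewrite fineK; last exact/integrable_fin_num/bounded_measurable_integrable.
apply: (@dominated_cvg _ _ _ P setT measurableT _ _ (fun=> M%:E)) => //.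
- by move=> n; exact/measurable_EFinP.
- by move=> w _; apply: cvg_EFin; [exact: nearW|exact: Ff].
- exact/(bounded_measurable_integrable (bounded_measurable_cst M)).
- by move=> n w _; rewrite /= lee_fin.
Qed.

End bounded_expectation.
Arguments Ex {d T R}.

(** * Bounded Lipschitz functions determine convergence in distribution *)

Section lipschitz_envelope.
Context {R : realType} {S : metricType R}.
Implicit Types (h : S -> R) (x y : S).

Definition bounded_lipschitz h := exists M L : R,
  [/\ 0 <= L, forall x, `|h x| <= M & forall x y, `|h x - h y| <= L * mdist x y].

(** The Pasch-Hausdorff envelope: the largest [k]-Lipschitz function below
[h]. *)
Definition envelope (k : R) h x : R :=
  inf [set h y + k * mdist x y | y in setT].

Variables (h : S -> R) (M : R).
Hypothesis hM : forall x, `|h x| <= M.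

Let env_lb k x : 0 <= k -> lbound [set h y + k * mdist x y | y in setT] (- M).
Proof.
move=> k0 _ [y _ <-]; have := hM y; rewrite ler_norml => /andP[h1 _].
by rewrite (le_trans h1)// lerDl mulr_ge0// mdist_ge0.
Qed.

Lemma envelope_le k x y : 0 <= k -> envelope k h x <= h y + k * mdist x y.
Proof.
move=> k0; apply: ge_inf; last by exists y.
by exists (- M); exact: env_lb.
Qed.

Lemma le_envelope k x c : (forall y, c <= h y + k * mdist x y) ->
  c <= envelope k h x.
Proof.
move=> hc; apply: lb_le_inf; first by exists (h x + k * mdist x x); exists x.
by move=> _ [y _ <-].
Qed.

Lemma envelope_le_self k x : 0 <= k -> envelope k h x <= h x.
Proof. by move=> k0; rewrite (le_trans (envelope_le x x k0))// mdistxx mulr0 addr0. Qed.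

Lemma envelope_bounded k x : 0 <= k -> `|envelope k h x| <= M.
Proof.
move=> k0; rewrite ler_norml; apply/andP; split.
  by apply: le_envelope => y; apply: env_lb k0 _ _; exists y.
rewrite (le_trans (envelope_le_self x k0))//.
by rewrite (le_trans (ler_norm _))// hM.
Qed.

Lemma envelope_bounded_lipschitz k : 0 <= k -> bounded_lipschitz (envelope k h).
Proof.
move=> k0; exists M, k; split => // [x|]; first exact: envelope_bounded.
have H x y : envelope k h x - envelope k h y <= k * mdist x y.
  rewrite lerBlDr -lerBlDl; apply: le_envelope => z; rewrite lerBlDl.
  rewrite (le_trans (envelope_le x z k0))// addrCA lerD2l -mulrDr ler_wpM2l//.
  exact: metric_triangle.
move=> x y; rewrite ler_norml H lerNl opprB andbT.
by rewrite (le_trans (H y x))// metric_sym.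
Qed.

(** Near [x] continuity bounds [h] from below; at distance at least [r] the
penalty [k r] exceeds the oscillation [2 M] of [h]. *)
Lemma envelope_cvg x : {for x, continuous h} ->
  envelope k%:R h x @[k --> \oo] --> h x.
Proof.
move=> hc; apply/cvgrPdist_le => e e0.
have /nbhs_ballP[r /= r0 hr] : nbhs x [set y | `|h x - h y| <= e].
  by move/cvgrPdist_le : hc; exact.
near=> k.
have kr : M *+ 2 <= k%:R * r.
  rewrite -ler_pdivrMr//; near: k; exact: nbhs_infty_ger.
rewrite ger0_norm ?subr_ge0 ?envelope_le_self// lerBlDl -lerBlDr.
apply: le_envelope => y; have [xy|xy] := ltP (mdist x y) r.
  have : ball x r y by rewrite ballEmdist.
  move=> /hr/=; rewrite ler_norml => /andP[_]; rewrite lerBlDr -lerBlDl => /le_trans.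
  by apply; rewrite lerDl mulr_ge0// mdist_ge0.
have := hM y; rewrite ler_norml => /andP[hy _].
have := hM x; rewrite ler_norml => /andP[_ hx].
have : k%:R * r <= k%:R * mdist x y by rewrite ler_wpM2l.
by move: kr; rewrite mulr2n; lra.
Unshelve. all: by end_near. Qed.

End lipschitz_envelope.

Section lipschitz_criterion.
Context {d : measure_display} {T : measurableType d} {R : realType}.
Variable P : probability T R.
Context {S : metricType R}.

(** An open set is the set where a Lipschitz envelope of its indicator is
positive. *)
Lemma borel_from_lipschitz (X : T -> S) :
  (forall h : S -> R, bounded_lipschitz h -> measurable_fun setT (h \o X)) ->
  borel_random_element X.
Proof.
move=> hX B; apply: (@smallest_sub _ _ _ [set B | measurable (X @^-1` B)]).
  split => /= [|A mA|F mF]; first by rewrite preimage_set0.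
    by rewrite setTD preimage_setC; exact: measurableC.
  by rewrite preimage_bigcup; exact: bigcup_measurable.
move=> U oU /=.
have iU (x : S) : `|\1_U x| <= (1 : R).
  by rewrite indicE; case: (_ \in _); rewrite ?normr1 ?normr0.
have -> : X @^-1` U = (envelope 1 (\1_U : S -> R) \o X) @^-1` `]0, +oo[.
  apply/seteqP; split => w /=; rewrite in_itv/= andbT => Uw.
    have /nbhs_ballP[r /= r0 hr] := open_nbhs_nbhs (conj oU Uw).
    apply: (@lt_le_trans _ _ (Num.min 1 r)); first by rewrite lt_min ltr01.
    apply: le_envelope => y; rewrite mul1r ge_min.
    have [Uy|Uy] := pselect (U y).
      by rewrite indicE mem_set// lerDl mdist_ge0.
    rewrite indicE memNset// add0r; apply/orP; right; rewrite leNgt; apply/negP => xy.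
    by apply/Uy/hr; rewrite ballEmdist; exact: xy.
  apply: contrapT => nUw; move: Uw; apply/negP; rewrite -leNgt.
  by rewrite (le_trans (envelope_le_self iU _ _))// indicE memNset.
rewrite -[X in measurable X]setTI; apply: hX => //.
exact: envelope_bounded_lipschitz iU _ _.
Qed.

Lemma cvg_in_distribution_lipschitz (X : nat -> T -> S) (Y : T -> S) :
  (forall n (h : S -> R), bounded_lipschitz h -> measurable_fun setT (h \o X n)) ->
  (forall h : S -> R, bounded_lipschitz h -> measurable_fun setT (h \o Y)) ->
  (forall h : S -> R, bounded_lipschitz h ->
    Ex P (h \o X n) @[n --> \oo] --> Ex P (h \o Y)) ->
  cvg_in_distribution P X Y.
Proof.
move=> mX mY XY; split; [by move=> n; exact/borel_from_lipschitz/mX|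
  exact/borel_from_lipschitz|].
have meas (h : S -> R) (Z : T -> S) M : continuous h -> (forall x, `|h x| <= M) ->
    (forall g : S -> R, bounded_lipschitz g -> measurable_fun setT (g \o Z)) ->
    measurable_fun setT (h \o Z).
  move=> hc hM mZ.
  apply: (@measurable_fun_cvg _ _ _ _ (fun k : nat => envelope k%:R h \o Z)).
    by move=> k; apply: mZ; exact: envelope_bounded_lipschitz hM _ _.
  by move=> w _; apply: (envelope_cvg hM); exact: hc.
(* one half of the convergence; the other half is the same for [- h] *)
have liminf (h : S -> R) M : continuous h -> (forall x, `|h x| <= M) ->
    forall e, 0 < e -> \forall n \near \oo,
      Ex P (h \o Y) - e <= Ex P (h \o X n).
  move=> hc hM e e0; have e20 : 0 < e / 2 by rewrite divr_gt0.
  have envL k := @envelope_bounded_lipschitz R S h M hM _ (ler0n R k).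
  have envM k x := @envelope_bounded R S h M hM _ x (ler0n R k).
  have : Ex P (envelope k%:R h \o Y) @[k --> \oo] --> Ex P (h \o Y).
    apply: (@Ex_cvg _ _ _ _ M); first by move=> k; exact/mY.
      by move=> k w; exact: envM.
    by move=> w; apply: (envelope_cvg hM); exact: hc.
  move/cvgrPdist_le => /(_ _ e20)[k _ /(_ _ (leqnn k))/=].
  rewrite ler_norml => /andP[_ hk].
  have := XY _ (envL k); move/cvgrPdist_le => /(_ _ e20).
  apply: filterS => n; rewrite ler_norml => /andP[_ hn].
  have : Ex P (envelope k%:R h \o X n) <= Ex P (h \o X n).
    apply: le_Ex => [||w].
    - by split; [exact/mX|exists M => w; exact: envM].
    - by split; [exact: meas hc hM (mX n)|exists M => w; exact: hM].
    - exact: envelope_le_self hM _ _ _.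
  by move: hk hn; rewrite /=; lra.
move=> h hc [M hM].
have bm (Z : T -> S) :
    (forall g : S -> R, bounded_lipschitz g -> measurable_fun setT (g \o Z)) ->
    bounded_measurable (h \o Z).
  by move=> mZ; split; [exact: meas hc hM mZ|exists M => w; exact: hM].
rewrite (expectationE _ (bm _ mY)).
under eq_cvg do rewrite (expectationE _ (bm _ (mX _))).
apply: cvg_EFin; first exact: nearW.
apply/cvgrPdist_le => e e0.
have Nc : continuous (\- h) by move=> x; apply: cvgN; exact: hc.
have NM x : `|(\- h) x| <= M by rewrite normrN.
have ExN Z : bounded_measurable (h \o Z) -> Ex P ((\- h) \o Z) = - Ex P (h \o Z).
  by move=> bZ; rewrite -mulN1r -ExZ//; congr Ex; apply/funext => w; rewrite mulN1r.
apply: filterS2 (liminf h M hc hM e e0) (liminf _ M Nc NM e e0) => n /=.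
rewrite (ExN _ (bm _ mY)) (ExN _ (bm _ (mX n))) ler_norml => h1 h2.
by apply/andP; split; lra.
Qed.

End lipschitz_criterion.

(** * Expectation of products of independent factors *)

Section product_expectation.
Context {d : measure_display} {T : measurableType d} {R : realType}.
Variable P : probability T R.

(** [g] rounded down to a multiple of [1 / (k + 1)], written as a finite
combination of indicators of superlevel sets. *)
Definition layers (g : R -> R) (k : nat) (x : R) : R :=
  k.+1%:R^-1 * \sum_(j < k.+1) \1_[set y | j.+1%:R <= k.+1%:R * g y] x.

Lemma layersE g k x : 0 <= g x <= 1 ->
  layers g k x = (Num.truncn (k.+1%:R * g x))%:R / k.+1%:R.
Proof.
move=> /andP[g0 g1]; rewrite /layers mulrC; congr (_ / _).
pose t := Num.truncn (k.+1%:R * g x).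
have tk : (t <= k.+1)%N.
  by rewrite truncn_le_nat -[ltRHS]natr1 ltr_pwDr// -[leRHS]mulr1 ler_pM2l// ltr0n.
have -> : t%:R = \sum_(j < t) 1 :> R by rewrite sumr_const card_ord.
rewrite (big_ord_widen k.+1 (fun=> 1))// [RHS]big_mkcond/=.
apply: eq_bigr => j _; rewrite indicE truncn_gt_nat.
by case: ifP => h; [rewrite mem_set|rewrite memNset//= h].
Qed.

Lemma layers_itv g k x : 0 <= g x <= 1 -> 0 <= layers g k x <= 1.
Proof.
move=> g01; have /andP[g0 g1] := g01; rewrite layersE// divr_ge0//=.
have := @truncn_itv _ (k.+1%:R * g x); rewrite mulr_ge0// => /(_ isT)/andP[+ _].
rewrite ler_pdivrMr ?ltr0n// mul1r => /le_trans; apply.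
by rewrite -[leRHS]mulr1 ler_pM2l// ltr0n.
Qed.

Lemma layers_cvg g x : 0 <= g x <= 1 -> layers g k x @[k --> \oo] --> g x.
Proof.
move=> g01; have /andP[g0 g1] := g01.
apply/cvgrPdist_le => e e0; near=> k.
have k0 : 0 < k.+1%:R :> R by rewrite ltr0n.
have ke : k.+1%:R^-1 <= e.
  by apply: ltW; near: k; exact: (near_infty_natSinv_lt (PosNum e0)).
apply: le_trans ke; rewrite layersE//.
have := @truncn_itv _ (k.+1%:R * g x); rewrite mulr_ge0// => /(_ isT)/andP[t1 t2].
rewrite ger0_norm; last by rewrite subr_ge0 ler_pdivrMr// [leRHS]mulrC.
rewrite lerBlDr -[X in X + _]mul1r -mulrDl ler_pdivlMr// mulrC addrC natr1.
exact: ltW.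
Unshelve. all: by end_near. Qed.

(** Both sides are linear in [g] and continuous under bounded limits, and every
[g] with values in [0, 1] is the limit of its layer sums. *)
Lemma Ex_mul_of_indic (X : T -> R) (W : T -> R) c (g : R -> R) :
  measurable_fun setT X -> bounded_measurable W ->
  (forall B, measurable B ->
    Ex P (fun w => W w * \1_B (X w)) = c * Ex P (fun w => \1_B (X w))) ->
  measurable_fun setT g -> (forall x, 0 <= g x <= 1) ->
  Ex P (fun w => W w * g (X w)) = c * Ex P (fun w => g (X w)).
Proof.
move=> mX bW hB mg g01; have [mW [M WM]] := bW.
have mlev j k : measurable [set y | j.+1%:R <= k.+1%:R * g y].
  rewrite -[X in measurable X]setTI.
  have : measurable_fun setT (fun y => k.+1%:R * g y) by exact: measurable_funM.
  move=> /(_ measurableT `[j.+1%:R, +oo[%classic (measurable_itv _)).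
  by congr measurable; apply/seteqP; split => y /=; rewrite in_itv/= andbT.
have bind B : measurable B -> bounded_measurable (fun w => \1_B (X w) : R).
  move=> mB; split; first by apply: measurableT_comp => //; exact: measurable_indic.
  by exists 1 => w; rewrite indicE; case: (_ \in _); rewrite ?normr1 ?normr0.
have blev k : bounded_measurable (fun w => layers g k (X w)).
  apply/bounded_measurableZ/bounded_measurable_sum => j.
  by apply: bind; exact: mlev.
have levE k : Ex P (fun w => W w * layers g k (X w)) =
    c * Ex P (fun w => layers g k (X w)).
  rewrite /layers ExZ; last first.
    by apply: bounded_measurable_sum => j; apply: bind; exact: mlev.
  rewrite Ex_sum; last by move=> j; apply: bind; exact: mlev.
  under eq_fun do rewrite mulrCA mulr_sumr.
  rewrite ExZ; last first.
    by apply: bounded_measurable_sum => j; apply: bounded_measurableM => //;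
      by apply: bind; exact: mlev.
  rewrite Ex_sum; last first.
    by move=> j; apply: bounded_measurableM => //; apply: bind; exact: mlev.
  rewrite mulrCA; congr (_ * _); rewrite mulr_sumr; apply: eq_bigr => j _.
  by apply: hB; exact: mlev.
have lev1 k x : `|layers g k x| <= 1.
  by have /andP[l0 l1] := layers_itv k (g01 x); rewrite ger0_norm.
have l1 : Ex P (fun w => W w * layers g k (X w)) @[k --> \oo] -->
    Ex P (fun w => W w * g (X w)).
  apply: (@Ex_cvg _ _ _ _ M).
  - by move=> k; have [] := bounded_measurableM bW (blev k).
  - by move=> k w; rewrite normrM -[leRHS]mulr1 ler_pM.
  - by move=> w; apply: cvgM; [exact: cvg_cst|exact: layers_cvg].
have l2 : c * Ex P (fun w => layers g k (X w)) @[k --> \oo] -->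
    c * Ex P (fun w => g (X w)).
  apply: cvgM; first exact: cvg_cst.
  apply: (@Ex_cvg _ _ _ _ 1) => //.
  - by move=> k; have [] := blev k.
  - by move=> w; exact: layers_cvg.
move: l1; under eq_cvg do rewrite levE; move=> l1.
by rewrite -(cvg_lim _ l1)// (cvg_lim _ l2).
Qed.

(** Independence of the weight [W] and of the first [K] variables.  A weight
rather than an event, because the proof of [Ex_prod] absorbs factors into it. *)
Definition product_rule (K : nat) (W : T -> R) (X : nat -> T -> R) : Prop :=
  forall B : nat -> set R, (forall i, measurable (B i)) ->
  Ex P (fun w => W w * \prod_(i < K) \1_(B i) (X i w)) =
  Ex P W * \prod_(i < K) Ex P (fun w => \1_(B i) (X i w)).

(** Induction on [K]: for a fixed event [B] of the last variable, its indicator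
is absorbed into the weight and the induction hypothesis applies; then [B] is
replaced by [g K] with [Ex_mul_of_indic]. *)
Lemma Ex_prod (K : nat) (W : T -> R) (X : nat -> T -> R) (g : nat -> R -> R) :
  bounded_measurable W -> (forall i, measurable_fun setT (X i)) ->
  product_rule K W X ->
  (forall i, measurable_fun setT (g i)) -> (forall i x, 0 <= g i x <= 1) ->
  Ex P (fun w => W w * \prod_(i < K) g i (X i w)) =
  Ex P W * \prod_(i < K) Ex P (fun w => g i (X i w)).
Proof.
move=> bW mX hW mg g01.
have bg i : bounded_measurable (fun w => g i (X i w)).
  split; first exact: measurableT_comp.
  by exists 1 => w; have /andP[g0 g1] := g01 i (X i w); rewrite ger0_norm.
have bind i B : measurable B -> bounded_measurable (fun w => \1_B (X i w) : R).
  move=> mB; split; first by apply: measurableT_comp => //; exact: measurable_indic.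
  by exists 1 => w; rewrite indicE; case: (_ \in _); rewrite ?normr1 ?normr0.
pose c := Ex P W; rewrite -/c.
move: hW; rewrite /product_rule -/c; move: (c) => {}c.
elim: K W bW c => [|K IH] W bW c hW.
  under eq_fun do rewrite big_ord0 mulr1.
  have := hW (fun=> setT) (fun=> measurableT); rewrite !big_ord0.
  by under eq_fun do rewrite big_ord0 mulr1.
under eq_fun do rewrite big_ord_recr/= mulrA.
rewrite big_ord_recr/= mulrA; apply: Ex_mul_of_indic => //.
  exact/bounded_measurableM/bounded_measurable_prod.
move=> B mB; under eq_fun do rewrite mulrAC.
rewrite mulrAC; apply: IH.
  exact/bounded_measurableM/bind.
move=> B' mB'; have := hW (fun i => if i == K then B else B' i).
rewrite big_ord_recr/= eqxx mulrA mulrAC.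
have Kneq (i : 'I_K) : (i == K :> nat) = false by rewrite ltn_eqF.
under eq_bigr do rewrite Kneq.
move=> <-; last by move=> i; case: ifP.
congr Ex; apply/funext => w; rewrite big_ord_recr/= eqxx mulrA mulrAC.
by under [in RHS]eq_bigr do rewrite Kneq.
Qed.

End product_expectation.

(** * Approximation of Lipschitz functions by products of bumps *)

Section double_limit.
Context {R : realType}.

(** The error [e n m] has to be small only after [n] has gone to infinity, so that
it may itself be an expectation that converges in [n]. *)
Lemma double_limit (a : nat -> R) (l : R) (b e : nat -> nat -> R) (b' e' : nat -> R) :
  (forall n m, `|a n - b n m| <= e n m) ->
  (forall m, b n m @[n --> \oo] --> b' m) ->
  (forall m, e n m @[n --> \oo] --> e' m) ->
  b' m @[m --> \oo] --> l -> e' m @[m --> \oo] --> 0 ->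
  a n @[n --> \oo] --> l.
Proof.
move=> ab bn en bl e0; apply/cvgrPdist_le => d d0.
have d40 : 0 < d / 4 by rewrite divr_gt0.
have [m [hb he]] : exists m, `|l - b' m| <= d / 4 /\ `|0 - e' m| <= d / 4.
  have : \forall m \near \oo, `|l - b' m| <= d / 4 /\ `|0 - e' m| <= d / 4.
    move/cvgrPdist_le : bl => /(_ _ d40) h1.
    move/cvgrPdist_le : e0 => /(_ _ d40) h2.
    by apply: filterS2 h1 h2.
  by move=> [m _ /(_ m (leqnn m))/= h]; exists m.
have := bn m; move/cvgrPdist_le => /(_ _ d40) h1.
have := en m; move/cvgrPdist_le => /(_ _ d40) h2.
apply: filterS2 h1 h2 => n; have := ab n m.
by move: hb he; rewrite !ler_norml => *; apply/andP; split; lra.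
Qed.

End double_limit.

Section bumps.
Context {R : realType}.
Implicit Types (m j : nat) (x : R).

Definition clamp (v : R) : R := Num.min 1 (Num.max 0 v).

Lemma clampP v : [\/ v <= 0 /\ clamp v = 0, 0 <= v <= 1 /\ clamp v = v |
  1 <= v /\ clamp v = 1].
Proof.
rewrite /clamp; have [v0|v0] := leP v 0; first by constructor 1; rewrite min_r.
by have [v1|v1] := leP 1 v; [constructor 3|constructor 2; rewrite !ltW].
Qed.

(** A continuous step from 0 to 1 of width [1 / (m + 1)], starting at
[j / (m + 1) - (m + 1)]. *)
Definition ramp m j x : R := clamp (m.+1%:R * x + m.+1%:R ^+ 2 - j%:R).

Definition bump m j x : R := ramp m j x - ramp m j.+1 x.

Definition bump_center m j : R := j.+1%:R / m.+1%:R - m.+1%:R.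

(** With this number of bumps the last ramp starts at [m + 1], so that the window
on which the bumps sum to 1 exhausts the line as [m] grows. *)
Definition nbumps m := (2 * m.+1 ^ 2)%N.

Definition plateau m x : R := \sum_(j < nbumps m) bump m j x.

Lemma bump_itv m j x : 0 <= bump m j x <= 1.
Proof.
rewrite /bump /ramp -[j.+1%:R]natr1.
set v := m.+1%:R * x + m.+1%:R ^+ 2; set k := (j%:R : R).
by have [[? ->]|[? ->]|[? ->]] := clampP (v - k);
   have [[? ->]|[? ->]|[? ->]] := clampP (v - (k + 1)); apply/andP; split; lra.
Qed.

Lemma bump_support m j x : bump m j x != 0 -> `|x - bump_center m j| <= m.+1%:R^-1.
Proof.
have m0 : 0 < m.+1%:R :> R by rewrite ltr0n.
move=> b0; rewrite -(ler_pM2l m0) divff ?gt_eqF// -[X in X * _](gtr0_norm m0) -normrM.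
have -> : m.+1%:R * (x - bump_center m j) =
    m.+1%:R * x + m.+1%:R ^+ 2 - (j%:R + 1).
  rewrite /bump_center opprB mulrDr mulrBr [_ * (_ / _)]mulrC divfK ?gt_eqF//.
  by rewrite -expr2 -[j.+1%:R]natr1 addrA.
move: b0; rewrite /bump /ramp -[j.+1%:R]natr1.
set v := m.+1%:R * x + m.+1%:R ^+ 2; set k := (j%:R : R); rewrite ler_norml.
apply: contraNT => h; apply/eqP; move: h; rewrite negb_and -!ltNge => h.
by have [[? ->]|[? ->]|[? ->]] := clampP (v - k);
   have [[? ->]|[? ->]|[? ->]] := clampP (v - (k + 1)); lra.
Qed.

(** Bumps are consecutive differences of ramps, so that they form a partition of
unity by telescoping. *)
Lemma plateauE m x : plateau m x = ramp m 0 x - ramp m (nbumps m) x.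
Proof.
rewrite /plateau -(big_mkord xpredT (fun j => bump m j x)).
rewrite -[RHS]opprB -(telescope_sumr (fun j => ramp m j x))// -sumrN.
by apply: eq_bigr => j _; rewrite opprB.
Qed.

Lemma plateau_itv m x : 0 <= plateau m x <= 1.
Proof.
rewrite {1}/plateau sumr_ge0/=; last first.
  by move=> j _; have /andP[] := bump_itv m j x.
rewrite plateauE /ramp; set v := _ - 0%:R; set w := _ - (nbumps m)%:R.
by have [[? ->]|[? ->]|[? ->]] := clampP v;
   have [[? ->]|[? ->]|[? ->]] := clampP w; lra.
Qed.

Lemma plateau_cvg x : plateau m x @[m --> \oo] --> (1 : R).
Proof.
apply/cvgrPdist_le => e e0; near=> m; rewrite (_ : plateau m x = 1).
  by rewrite subrr normr0 ltW.
have m0 : 0 < m.+1%:R :> R by rewrite ltr0n.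
have m1 : 1 <= m.+1%:R :> R by rewrite ler1n.
have xm : `|x| + 1 <= m.+1%:R.
  rewrite (@le_trans _ _ m%:R) ?ler_nat//.
  by near: m; exact: nbhs_infty_ger.
have /andP[x1 x2] : - `|x| <= x <= `|x| by rewrite -ler_norml.
have h1 : 1 <= m.+1%:R * x + m.+1%:R ^+ 2 :> R.
  rewrite expr2 -mulrDr -[leLHS]mulr1 ler_pM//; lra.
have h2 : m.+1%:R * x + m.+1%:R ^+ 2 - (nbumps m)%:R <= 0 :> R.
  have : m.+1%:R * x <= m.+1%:R * m.+1%:R by rewrite ler_pM2l//; lra.
  by rewrite natrM natrX expr2; lra.
rewrite plateauE /ramp /clamp (max_l h2) (min_r ler01) !subr0.
by rewrite min_l// le_max h1 orbT.
Unshelve. all: by end_near. Qed.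

Lemma ramp_continuous m j : continuous (ramp m j).
Proof.
move=> x; pose v (y : R) : R^o := m.+1%:R * y + m.+1%:R ^+ 2 - j%:R.
have cv : {for x, continuous v}.
  apply: cvgB; last exact: cvg_cst.
  apply: cvgD; last exact: cvg_cst.
  by apply: cvgM; [exact: cvg_cst|exact: cvg_id].
have c1 : {for x, continuous ((fun=> 0 : R^o) \max v)}.
  by apply: continuous_max cv; exact: cvg_cst.
have c2 : {for x, continuous ((fun=> 1 : R^o) \min ((fun=> 0) \max v))}.
  by apply: continuous_min c1; exact: cvg_cst.
exact: c2.
Qed.

Lemma bump_continuous m j : continuous (bump m j).
Proof. by move=> x; apply: cvgB; exact: ramp_continuous. Qed.

Lemma plateau_continuous m : continuous (plateau m).
Proof.
move=> x; apply: (@cvg_big _ _ _ _ predT); first exact: add_continuous.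
by move=> j _; exact: bump_continuous.
Qed.

End bumps.

Section bump_approximation.
Context {R : realType}.
Variables (F : (nat -> R) -> R) (K : nat) (L M : R).
Hypothesis L0 : 0 <= L.
Hypothesis FM : forall x, `|F x| <= M.
Hypothesis FL : forall x y, `|F x - F y| <= L * \sum_(i < K) `|x i - y i|.

Definition bump_node m (c : {ffun 'I_K -> 'I_(nbumps m)}) (i : nat) : R :=
  if insub i is Some i' then bump_center m (c i') else 0.

Definition bump_approx m (x : nat -> R) : R :=
  \sum_(c : {ffun 'I_K -> 'I_(nbumps m)})
    F (bump_node c) * \prod_(i < K) bump m (c i) (x i).

(** The first term is the oscillation of [F] on a product of bump supports; the
second one is the mass missing outside of the window.  The latter is again a
product, so its expectation converges: this plays the part of tightness. *)
Definition bump_error m (x : nat -> R) : R :=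
  L * K%:R / m.+1%:R + M * (1 - \prod_(i < K) plateau m (x i)).

Lemma bump_approx_dist m x : `|F x - bump_approx m x| <= bump_error m x.
Proof.
set pl := \prod_(i < K) plateau m (x i).
have plE : pl = \sum_(c : {ffun 'I_K -> 'I_(nbumps m)})
    \prod_(i < K) bump m (c i) (x i).
  by rewrite /pl /plateau bigA_distr_bigA.
have pl0 : 0 <= pl by apply: prodr_ge0 => i _; have /andP[] := plateau_itv m (x i).
have pl1 : pl <= 1.
  by apply: prodr_ile1 => i _; exact: plateau_itv.
have -> : F x - bump_approx m x = F x * (1 - pl) +
    \sum_(c : {ffun 'I_K -> 'I_(nbumps m)})
      (F x - F (bump_node c)) * \prod_(i < K) bump m (c i) (x i).
  rewrite mulrBr mulr1 -addrA; congr (_ + _).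
  under [in RHS]eq_bigr do rewrite mulrBl.
  by rewrite sumrB -mulr_sumr -plE addKr.
rewrite (le_trans (ler_normD _ _))// addrC lerD//; last first.
  by rewrite normrM [X in _ * X]ger0_norm ?subr_ge0// ler_wpM2r// subr_ge0.
have LKm : 0 <= L * K%:R / m.+1%:R by rewrite divr_ge0// mulr_ge0.
apply: (@le_trans _ _ (L * K%:R / m.+1%:R * pl)); last first.
  by rewrite -[leRHS]mulr1 ler_wpM2l.
rewrite plE mulr_sumr (le_trans (ler_norm_sum _ _ _))// ler_sum// => c _.
have b0 i : 0 <= bump m (c i) (x i) by have /andP[] := bump_itv m (c i) (x i).
rewrite normrM [X in _ * X]ger0_norm; last exact: prodr_ge0.
have [->|/prodf_neq0 bn0] := eqVneq (\prod_(i < K) bump m (c i) (x i)) 0.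
  by rewrite !mulr0.
rewrite ler_wpM2r ?prodr_ge0// (le_trans (FL _ _))// -!mulrA ler_wpM2l//.
have -> : K%:R / m.+1%:R = \sum_(i < K) m.+1%:R^-1 :> R.
  by rewrite sumr_const card_ord mulr_natl.
by apply: ler_sum => i _; rewrite /bump_node valK; exact/bump_support/bn0.
Qed.

Lemma bump_error_le m x : `|bump_error m x| <= L * K%:R + M.
Proof.
have M0 : 0 <= M by rewrite (le_trans _ (FM x)).
rewrite /bump_error; set pl := \prod_(i < K) plateau m (x i).
have pl0 : 0 <= pl by apply: prodr_ge0 => i _; have /andP[] := plateau_itv m (x i).
have pl1 : pl <= 1 by apply: prodr_ile1 => i _; exact: plateau_itv.
have LK0 : 0 <= L * K%:R by rewrite mulr_ge0.
rewrite ger0_norm; last by rewrite addr_ge0// ?divr_ge0// mulr_ge0// subr_ge0.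
apply: lerD; first by rewrite ler_pdivrMr// ler_peMr// ler1n.
by rewrite ler_piMr// gerBl.
Qed.

Lemma bump_error_cvg x : bump_error m x @[m --> \oo] --> (0 : R).
Proof.
have -> : 0 = L * K%:R * 0 + M * (1 - \prod_(i < K) 1) :> R.
  by rewrite big1// subrr !mulr0 addr0.
apply: cvgD.
  by apply: cvgM; [exact: cvg_cst|exact: cvg_harmonic].
apply: cvgM; first exact: cvg_cst.
apply: cvgB; first exact: cvg_cst.
apply: (@cvg_big _ _ _ _ predT); first exact: mul_continuous.
by move=> i _; exact: plateau_cvg.
Qed.

Lemma bump_approx_cvg x : bump_approx m x @[m --> \oo] --> F x.
Proof.
apply/cvgrPdist_le => e e0.
have := bump_error_cvg x; move/cvgrPdist_le => /(_ _ e0).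
apply: filterS => m; rewrite sub0r normrN => h.
exact: le_trans (bump_approx_dist m x) (le_trans (ler_norm _) h).
Qed.

End bump_approximation.

(** * Convergence of weighted expectations in finite dimension *)

Section finite_dimensional_convergence.
Context {d : measure_display} {T : measurableType d} {R : realType}.
Variable P : probability T R.
Variables (F : (nat -> R) -> R) (K : nat) (L M : R).
Hypothesis L0 : 0 <= L.
Hypothesis FM : forall x, `|F x| <= M.
Hypothesis FL : forall x y, `|F x - F y| <= L * \sum_(i < K) `|x i - y i|.

Let mbump m j (X : T -> R) : measurable_fun setT X ->
  bounded_measurable (fun w => bump m j (X w)).
Proof.
move=> mX; split.
  apply: measurableT_comp => //; apply: continuous_measurable_fun; exact: bump_continuous.
by exists 1 => w; have /andP[b0 b1] := bump_itv m j (X w); rewrite ger0_norm.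
Qed.

Let mplateau m (X : T -> R) : measurable_fun setT X ->
  bounded_measurable (fun w => plateau m (X w)).
Proof. by move=> mX; apply: bounded_measurable_sum => j; exact: mbump. Qed.

Let bapprox m (X : nat -> T -> R) : (forall i, measurable_fun setT (X i)) ->
  bounded_measurable (fun w => bump_approx F K m (X ^~ w)).
Proof.
move=> mX; apply: bounded_measurable_sum => c; apply: bounded_measurableZ.
by apply: bounded_measurable_prod => i; exact: mbump.
Qed.

Lemma finite_dim_bounded_measurable (X : nat -> T -> R) :
  (forall i, measurable_fun setT (X i)) ->
  bounded_measurable (fun w => F (X ^~ w)).
Proof.
move=> mX; split; last by exists M.
apply: (@measurable_fun_cvg _ _ _ _ (fun m w => bump_approx F K m (X ^~ w))).
  by move=> m; have [] := bapprox m mX.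
by move=> w _; exact: bump_approx_cvg L0 FM FL _.
Qed.

Let Ex_approx m (W : T -> R) (X : nat -> T -> R) : bounded_measurable W ->
  (forall i, measurable_fun setT (X i)) -> product_rule P K W X ->
  Ex P (fun w => W w * bump_approx F K m (X ^~ w)) =
  \sum_(c : {ffun 'I_K -> 'I_(nbumps m)}) F (bump_node c) *
    (Ex P W * \prod_(i < K) Ex P (fun w => bump m (c i) (X i w))).
Proof.
move=> bW mX hX; under eq_fun do rewrite mulr_sumr.
rewrite Ex_sum; last first.
  move=> c; apply: bounded_measurableM => //; apply: bounded_measurableZ.
  by apply: bounded_measurable_prod => i; exact: mbump.
apply: eq_bigr => c _; under eq_fun do rewrite mulrCA.
rewrite ExZ; last first.
  apply: bounded_measurableM => //.
  by apply: bounded_measurable_prod => i; exact: mbump.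
congr (_ * _).
pose j i : nat := if insub i is Some i' then nat_of_ord (c i') else 0%N.
have jE (i : 'I_K) : j i = c i by rewrite /j valK.
have mb i : measurable_fun setT (bump m (j i) : R -> R).
  by apply: continuous_measurable_fun; exact: bump_continuous.
have := Ex_prod bW mX hX mb (fun i => bump_itv m (j i)).
under [X in _ = _ * X -> _]eq_bigr do rewrite jE.
move=> <-; congr Ex; apply/funext => w; congr (_ * _).
by apply: eq_bigr => i _; rewrite jE.
Qed.

Let Ex_error m (W : T -> R) (X : nat -> T -> R) : bounded_measurable W ->
  (forall i, measurable_fun setT (X i)) -> product_rule P K W X ->
  Ex P (fun w => W w * bump_error K L M m (X ^~ w)) =
  Ex P W * (L * K%:R / m.+1%:R +
    M * (1 - \prod_(i < K) Ex P (fun w => plateau m (X i w)))).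
Proof.
move=> bW mX hX; set a := L * K%:R / m.+1%:R.
have bpl : bounded_measurable (fun w => \prod_(i < K) plateau m (X i w)).
  by apply: bounded_measurable_prod => i; exact: mplateau.
have -> : (fun w => W w * bump_error K L M m (X ^~ w)) =
    (fun w => (a + M) * W w - M * (W w * \prod_(i < K) plateau m (X i w))).
  by apply/funext => w; rewrite /bump_error -/a; ring.
have bWpl := bounded_measurableM bW bpl.
rewrite ExB; [|exact: bounded_measurableZ..].
have mpl (i : nat) : measurable_fun setT (plateau m : R -> R).
  by apply: continuous_measurable_fun; exact: plateau_continuous.
rewrite ExZ// ExZ// (Ex_prod bW mX hX mpl (fun=> plateau_itv m)).
by ring.
Qed.

(** For a fixed mesh the approximation and its error are polynomials in one-variable
expectations, hence converge in [n]; the error in the limit law vanishes with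
the mesh. *)
Lemma finite_dim_cvg (W : T -> R) (X : nat -> nat -> T -> R) (Y : nat -> T -> R) :
  bounded_measurable W -> (forall w, 0 <= W w) ->
  (forall n i, measurable_fun setT (X n i)) ->
  (forall i, measurable_fun setT (Y i)) ->
  (forall n, product_rule P K W (X n)) -> product_rule P K W Y ->
  (forall i (g : R -> R), continuous g -> (exists B, forall x, `|g x| <= B) ->
    Ex P (fun w => g (X n i w)) @[n --> \oo] --> Ex P (fun w => g (Y i w))) ->
  Ex P (fun w => W w * F (X n ^~ w)) @[n --> \oo] -->
  Ex P (fun w => W w * F (Y ^~ w)).
Proof.
move=> bW W0 mX mY hX hY XY.
have bump1 m j : exists B, forall x : R, `|bump m j x| <= B.
  by exists 1 => x; have /andP[b0 b1] := bump_itv m j x; rewrite ger0_norm.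
have plateau1 m : exists B, forall x : R, `|plateau m x| <= B.
  by exists 1 => x; have /andP[b0 b1] := plateau_itv m x; rewrite ger0_norm.
have berr m (Z : nat -> T -> R) : (forall i, measurable_fun setT (Z i)) ->
    bounded_measurable (fun w => bump_error K L M m (Z ^~ w)).
  move=> mZ; apply: bounded_measurableD; first exact: bounded_measurable_cst.
  apply/bounded_measurableZ/bounded_measurableB.
    exact: bounded_measurable_cst.
  by apply: bounded_measurable_prod => i; exact: mplateau.
have dist m (Z : nat -> T -> R) : (forall i, measurable_fun setT (Z i)) ->
    `|Ex P (fun w => W w * F (Z ^~ w)) -
      Ex P (fun w => W w * bump_approx F K m (Z ^~ w))| <=
    Ex P (fun w => W w * bump_error K L M m (Z ^~ w)).
  move=> mZ; have bFZ := finite_dim_bounded_measurable mZ.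
  rewrite -ExB; [|exact: bounded_measurableM|exact/bounded_measurableM/bapprox].
  apply: Ex_norm_le => [||w].
  - by apply: bounded_measurableB; [exact: bounded_measurableM|
      exact/bounded_measurableM/bapprox].
  - exact/bounded_measurableM/berr.
  - by rewrite -mulrBr normrM ger0_norm// ler_wpM2l//; exact: bump_approx_dist.
have errY : Ex P (fun w => W w * bump_error K L M m (Y ^~ w)) @[m --> \oo] -->
    (0 : R).
  have [mW [B WB]] := bW; rewrite -[0](Ex_cst P).
  apply: (@Ex_cvg _ _ _ _ (B * (L * K%:R + M))).
  - by move=> m; have [] := bounded_measurableM bW (berr m _ mY).
  - by move=> m w; rewrite normrM ler_pM// (bump_error_le K L0 FM).
  - move=> w; rewrite -[0](mulr0 (W w)).
    by apply: cvgM; [exact: cvg_cst|exact: bump_error_cvg].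
apply: (@double_limit _ _ _
  (fun n m => Ex P (fun w => W w * bump_approx F K m (X n ^~ w)))
  (fun n m => Ex P (fun w => W w * bump_error K L M m (X n ^~ w)))
  (fun m => Ex P (fun w => W w * bump_approx F K m (Y ^~ w)))
  (fun m => Ex P (fun w => W w * bump_error K L M m (Y ^~ w)))).
- by move=> n m; exact: dist.
- move=> m; under eq_cvg do rewrite Ex_approx//.
  rewrite Ex_approx//; apply: (@cvg_big _ _ _ _ predT); first exact: add_continuous.
  move=> c _; apply: cvgM; first exact: cvg_cst.
  apply: cvgM; first exact: cvg_cst.
  apply: (@cvg_big _ _ _ _ predT); first exact: mul_continuous.
  by move=> i _; apply: XY => //; exact: bump_continuous.
- move=> m; under eq_cvg do rewrite Ex_error//.
  rewrite Ex_error//; apply: cvgM; first exact: cvg_cst.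
  apply: cvgD; first exact: cvg_cst.
  apply: cvgM; first exact: cvg_cst.
  apply: cvgB; first exact: cvg_cst.
  apply: (@cvg_big _ _ _ _ predT); first exact: mul_continuous.
  by move=> i _; apply: XY => //; exact: plateau_continuous.
- apply/cvgrPdist_le => e e0; move/cvgrPdist_le : errY => /(_ _ e0).
  apply: filterS => m; rewrite sub0r normrN => h.
  exact: le_trans (dist m _ mY) (le_trans (ler_norm _) h).
- exact: errY.
Qed.

End finite_dimensional_convergence.

(** * From independent sigma-algebras to the product rule *)

Section independence.
Context {d : measure_display} {T : measurableType d} {R : realType}.
Variable P : probability T R.

Lemma sigma_generated_bigcap (I J : Type) d' (S : measurableType d') (D : set I)
    (X : I -> T -> S) (E : set J) (f : J -> I) (B : J -> set S) :
  finite_set E -> (forall j, E j -> D (f j)) -> (forall j, measurable (B j)) ->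
  sigma_generated D X (\bigcap_(j in E) X (f j) @^-1` B j).
Proof.
move=> fE fD mB; pose G := \bigcup_(i in D) preimage_set_system setT (X i) measurable.
apply: (@fin_bigcap_measurable _ (g_sigma_algebraType G) _ E) => // j Ej.
apply: sub_sigma_algebra; exists (f j); first exact: fD.
by exists (B j) => //; rewrite setTI.
Qed.

Lemma sigma_generated_measurable (I : Type) d' (S : measurableType d') (D : set I)
    (X : I -> T -> S) (A : set T) : (forall i, D i -> measurable_fun setT (X i)) ->
  sigma_generated D X A -> measurable A.
Proof.
move=> mX; apply: smallest_sub; first exact: sigma_algebra_measurable.
by move=> _ [i Di [B mB <-]]; exact: mX.
Qed.

Lemma product_rule_indic (K : nat) (FF : set (set T)) (A : set T) (X : nat -> T -> R) :
  independent_classes P FF (sigma_generated [set: nat] X) -> FF A -> measurable A ->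
  (forall i, measurable_fun setT (X i)) -> mutually_independent P X ->
  product_rule P K \1_A X.
Proof.
move=> hF FA mA mX hX B mB.
pose E := \bigcap_(i in [set` iota 0 K]) X i @^-1` B i.
have sE : sigma_generated [set: nat] X E.
  by apply: (@sigma_generated_bigcap _ _ _ _ _ X _ id) => //; exact: finite_seq.
have mE : measurable E by apply: sigma_generated_measurable sE => i _; exact: mX.
have mXB i : measurable (X i @^-1` B i) by rewrite -[X in measurable X]setTI; exact: mX.
have -> : (fun w => \1_A w * \prod_(i < K) \1_(B i) (X i w)) =
    \1_(A `&` E) :> (T -> R).
  apply/funext => w; rewrite indicI/=; congr (_ * _).
  rewrite [RHS]indicE; have [wE|wE] := pselect (E w).
    rewrite mem_set// big1// => i _; rewrite indicE mem_set//.
    by apply: (wE i); rewrite /= mem_iota/=.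
  rewrite memNset//; have [i [iK wi]] : exists i, (i < K)%N /\ ~ B i (X i w).
    apply: contrapT => h; apply: wE => i; rewrite /= mem_iota/= add0n => iK.
    by apply: contrapT => ni; apply: h; exists i.
  by rewrite (bigD1 (Ordinal iK))//= [X in X * _]indicE memNset// mul0r.
rewrite !Ex_indic//; last exact: measurableI.
have -> : \prod_(i < K) Ex P (fun w => \1_(B i) (X i w)) =
    \prod_(i <- iota 0 K) fine (P (X i @^-1` B i)).
  rewrite -(big_mkord xpredT (fun i => Ex P (fun w => \1_(B i) (X i w)))).
  rewrite /index_iota subn0; apply: eq_bigr => i _; rewrite -Ex_indic//.
rewrite (hF _ _ FA sE) (hX (iota 0 K) B (iota_uniq _ _) mB) fineM ?fin_num_measure//.
  congr (_ * _); elim: (iota 0 K) => [|i s IH]; first by rewrite !big_nil.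
  by rewrite !big_cons fineM ?fin_num_measure ?IH//; apply: prode_fin_num => *;
    exact: fin_num_measure.
by apply: prode_fin_num => *; exact: fin_num_measure.
Qed.

End independence.

(** * Sampled compound processes *)

Section sampling.
Context {R : realType}.

(** The values of a jump path at the [m + 2] grid points [0, ..., (m + 1) / (m + 1)],
truncated at [m]: a finite type, so that a sampled process is a finite sum over
its codes. *)
Definition code m := {ffun 'I_m.+2 -> 'I_m.+1}.

Definition encode m (p : R -> nat) : code m :=
  [ffun k : 'I_m.+2 => inord (minn (p (k%:R / m.+1%:R)) m)].

Definition decode m (c : code m) (k : nat) : nat := c (inord k).

Definition sampled_path m (c : code m) (x : nat -> R) : skorohod R :=
  compound_path (grid_fun m (decode c)) (grid_fun_cadlag m (decode c)) x.

Lemma sampled_path_lipschitz m (c : code m) x y :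
  mdist (sampled_path c x) (sampled_path c y) <= \sum_(i < m) `|x i - y i|.
Proof. by apply: skorohod_dist_summands => t; rewrite -ltnS; exact: ltn_ord. Qed.

(** Truncation at [m] is harmless for large [m], since a jump path is bounded; its
bound is that of the compound path with unit summands. *)
Lemma sampled_path_dist (p : R -> nat)
    (cp : cadlag (fun t : (`[0, +oo[%classic : set R) => p (set_val t))) :
  exists C, \forall m \near \oo, forall x,
    mdist (compound_path p cp x) (sampled_path (encode m p) x) <= C / m.+1%:R.
Proof.
have [M HM] := skorohod_bounded (compound_path p cp (fun=> 1)).
have pM (t : I01 R) : (p (set_val t))%:R <= M.
  have := HM t; rewrite /= sumr_const card_ord ger0_norm//.
have [C hC] := grid_sampling (cadlag_restrict (@I01_sub_nonneg R) cp).
exists C; near=> m => x.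
have mM : M <= m%:R by near: m; exact: nbhs_infty_ger.
have [lam tl hl] : exists2 lam : I01 R -> I01 R,
    time_change lam & forall t : I01 R, `|set_val (lam t) - set_val t| <= C / m.+1%:R /\
     p (set_val t) = p ((Num.truncn (m.+1%:R * set_val (lam t)))%:R / m.+1%:R).
  by near: m; exact: hC.
apply: (skorohod_dist_time_change _ _ _ tl) => t; have [h1 h2] := hl t; split => //.
have ptm : (p (set_val t) <= m)%N.
  by rewrite -(ler_nat R) (le_trans (pM t)).
rewrite /grid_fun /decode ffunE inordK ?ltnS ?geq_minr//.
rewrite inordK; first by rewrite -h2 (minn_idPl ptm).
rewrite ltnS truncn_le_nat (@le_lt_trans _ _ m.+1%:R) ?ltr_nat//.
by rewrite -[leRHS]mulr1 ler_pM2l// I01_le1.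
Unshelve. all: by end_near. Qed.

End sampling.

Section compound_process.
Context {d : measure_display} {T : measurableType d} {R : realType}.
Variable P : probability T R.
Variable N : R -> T -> nat.
Hypothesis mN : forall t, 0 <= t -> measurable_fun setT (N t).
Hypothesis cN : forall w,
  cadlag (fun t : (`[0, +oo[%classic : set R) => N (set_val t) w).

Definition compound_process (X : nat -> T -> R) (w : T) : skorohod R :=
  compound_path (fun t => N t w) (cN w) (X ^~ w).

Definition sampled_process m (X : nat -> T -> R) (w : T) : skorohod R :=
  sampled_path (encode m (fun t => N t w)) (X ^~ w).

Definition code_event m (c : code m) : set T :=
  [set w | encode m (fun t => N t w) = c].

Lemma code_event_generated m (c : code m) :
  sigma_generated [set t : R | 0 <= t] N (code_event c).
Proof.
have -> : code_event c = \bigcap_(k in [set: 'I_m.+2])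
    N (k%:R / m.+1%:R) @^-1` [set n | minn n m = c k].
  apply/seteqP; split => w /= => [<- k _ /=|h].
    by rewrite ffunE inordK// ltnS geq_minr.
  apply/ffunP => k; rewrite ffunE; apply/val_inj => /=.
  by rewrite inordK ?ltnS ?geq_minr//; exact: h.
apply: (sigma_generated_bigcap (f := fun k : 'I_m.+2 => k%:R / m.+1%:R)
  (B := fun k : 'I_m.+2 => [set n | minn n m = c k])) => // k _ /=.
by rewrite divr_ge0.
Qed.

Lemma code_event_measurable m (c : code m) : measurable (code_event c).
Proof.
exact: (sigma_generated_measurable mN (code_event_generated c)).
Qed.

Section bounded_lipschitz_functional.
Variables (h : skorohod R -> R) (M L : R).
Hypothesis L0 : 0 <= L.
Hypothesis hM : forall x, `|h x| <= M.
Hypothesis hL : forall x y, `|h x - h y| <= L * mdist x y.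

Let F m (c : code m) (x : nat -> R) := h (sampled_path c x).

Let FM m (c : code m) x : `|F c x| <= M. Proof. exact: hM. Qed.

Let FL m (c : code m) x y : `|F c x - F c y| <= L * \sum_(i < m) `|x i - y i|.
Proof.
by rewrite (le_trans (hL _ _))// ler_wpM2l// sampled_path_lipschitz.
Qed.

Let sampled_sum m (X : nat -> T -> R) w : h (sampled_process m X w) =
  \sum_(c : code m) \1_(code_event c) w * F c (X ^~ w).
Proof.
rewrite (bigD1 (encode m (fun t => N t w)))//= indicE mem_set// mul1r.
rewrite big1 ?addr0// => c cw; rewrite indicE memNset ?mul0r// => e.
by move: cw; rewrite -e eqxx.
Qed.

Let sampled_measurable m (X : nat -> T -> R) : (forall i, measurable_fun setT (X i)) ->
  bounded_measurable (fun w => h (sampled_process m X w)).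
Proof.
move=> mX; under eq_fun do rewrite sampled_sum.
apply: bounded_measurable_sum => c; apply: bounded_measurableM.
  exact/bounded_measurable_indic/code_event_measurable.
exact: finite_dim_bounded_measurable L0 (FM c) (FL c) _ mX.
Qed.

Let sampled_dist (w : T) : exists C, \forall m \near \oo, forall X,
  `|h (compound_process X w) - h (sampled_process m X w)| <= C / m.+1%:R.
Proof.
have [C hC] := @sampled_path_dist R (fun t => N t w) (cN w); exists (L * C).
apply: filterS hC => m hC X; rewrite (le_trans (hL _ _))// -mulrA ler_wpM2l//.
exact: hC.
Qed.

Let sampled_cvg X w :
  h (sampled_process m X w) @[m --> \oo] --> h (compound_process X w).
Proof.
have [C hC] := sampled_dist w.
have Cm : C / m.+1%:R @[m --> \oo] --> (0 : R).
  by rewrite -(mulr0 C); apply: cvgM; [exact: cvg_cst|exact: cvg_harmonic].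
apply/cvgrPdist_le => e e0; move/cvgrPdist_le : Cm => /(_ _ e0).
apply: filterS2 hC => m /(_ X) h1; rewrite sub0r normrN => h2.
exact: le_trans h1 (le_trans (ler_norm _) h2).
Qed.

Lemma compound_process_bounded_measurable (X : nat -> T -> R) :
  (forall i, measurable_fun setT (X i)) ->
  bounded_measurable (fun w => h (compound_process X w)).
Proof.
move=> mX; split; last by exists M.
apply: (@measurable_fun_cvg _ _ _ _ (fun m w => h (sampled_process m X w))).
  by move=> m; have [] := sampled_measurable m mX.
by move=> w _; exact: sampled_cvg.
Qed.

(** For bounded Lipschitz functionals the convergence holds for the sampled
processes, code by code, and passes to the limit of the mesh. *)
Lemma compound_process_cvg (X : nat -> nat -> T -> R) (Y : nat -> T -> R) :
  (forall n i, measurable_fun setT (X n i)) ->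
  (forall i, measurable_fun setT (Y i)) ->
  (forall n, mutually_independent P (X n)) -> mutually_independent P Y ->
  (forall n, independent_classes P (sigma_generated [set t : R | 0 <= t] N)
     (sigma_generated [set: nat] (X n))) ->
  independent_classes P (sigma_generated [set t : R | 0 <= t] N)
     (sigma_generated [set: nat] Y) ->
  (forall i (g : R -> R), continuous g -> (exists B, forall x, `|g x| <= B) ->
    Ex P (fun w => g (X n i w)) @[n --> \oo] --> Ex P (fun w => g (Y i w))) ->
  Ex P (fun w => h (compound_process (X n) w)) @[n --> \oo] -->
  Ex P (fun w => h (compound_process Y w)).
Proof.
move=> mX mY iX iY iNX iNY XY.
have bX n := compound_process_bounded_measurable (mX n).
have bY := compound_process_bounded_measurable mY.
have bsX n m := sampled_measurable m (mX n).
have bsY m := sampled_measurable m mY.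
pose D m n w := `|h (compound_process (X n) w) - h (sampled_process m (X n) w)|.
have DM m n w : D m n w <= M + M.
  by rewrite (le_trans (ler_normB _ _))// lerD.
have Dub m w : has_ubound (range ((D m) ^~ w)).
  by exists (M + M) => _ [n _ <-].
(* the supremum over [n] makes the error uniform in [n] while keeping it
   measurable; it tends to 0 pointwise because [sampled_dist] is uniform in
   the summands *)
pose S m w := sups ((D m) ^~ w) 0.
have DS m n w : D m n w <= S m w.
  apply: ub_le_sup; last by exists n.
  by exists (M + M) => _ [k _ <-].
have S_le m w c : (forall n, D m n w <= c) -> S m w <= c.
  move=> Dc; apply: ge_sup; first by exists (D m 0%N w); exists 0%N.
  by move=> _ [k _ <-].
have S0 m w : 0 <= S m w by exact: le_trans (normr_ge0 _) (DS m 0%N w).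
have bS m : bounded_measurable (S m).
  split; last by exists (M + M) => w; rewrite ger0_norm// S_le.
  apply: measurable_fun_sups => // n.
  by have [] := bounded_measurable_norm (bounded_measurableB (bX n) (bsX n m)).
have ExS : Ex P (S m) @[m --> \oo] --> (0 : R).
  rewrite -[0](Ex_cst P); apply: (@Ex_cvg _ _ _ _ (M + M)).
  - by move=> m; have [] := bS m.
  - by move=> m w; rewrite ger0_norm// S_le.
  move=> w; have [C hC] := sampled_dist w.
  have Cm : C / m.+1%:R @[m --> \oo] --> (0 : R).
    by rewrite -(mulr0 C); apply: cvgM; [exact: cvg_cst|exact: cvg_harmonic].
  apply/cvgrPdist_le => e e0; move/cvgrPdist_le : Cm => /(_ _ e0).
  apply: filterS2 hC => m h1; rewrite !sub0r !normrN => h2.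
  rewrite ger0_norm// S_le// => n.
  exact: le_trans (h1 (X n)) (le_trans (ler_norm _) h2).
apply: (@double_limit _ _ _
  (fun n m => Ex P (fun w => h (sampled_process m (X n) w)))
  (fun _ m => Ex P (S m))
  (fun m => Ex P (fun w => h (sampled_process m Y w)))
  (fun m => Ex P (S m))) => //.
- move=> n m; rewrite -ExB//; apply: Ex_norm_le => //.
    exact: bounded_measurableB.
  by move=> w; exact: DS.
- move=> m.
  have sumE (Z : nat -> T -> R) : (forall i, measurable_fun setT (Z i)) ->
      Ex P (fun w => h (sampled_process m Z w)) =
      \sum_(c : code m) Ex P (fun w => \1_(code_event c) w * F c (Z ^~ w)).
    move=> mZ; under eq_fun do rewrite sampled_sum.
    rewrite Ex_sum// => c; apply: bounded_measurableM.
      exact/bounded_measurable_indic/code_event_measurable.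
    exact: finite_dim_bounded_measurable L0 (FM c) (FL c) _ mZ.
  under eq_cvg do rewrite sumE//.
  rewrite sumE//; apply: (@cvg_big _ _ _ _ predT); first exact: add_continuous.
  move=> c _; apply: (finite_dim_cvg L0 (FM c) (FL c)) => //.
  + exact/bounded_measurable_indic/code_event_measurable.
  + move=> n; apply: product_rule_indic (iNX n) _ _ _ (iX n) => //.
      exact: code_event_generated.
    exact: code_event_measurable.
  + apply: product_rule_indic iNY _ _ _ iY => //.
      exact: code_event_generated.
    exact: code_event_measurable.
- by move=> m; exact: cvg_cst.
- apply: (@Ex_cvg _ _ _ _ M) => //.
  by move=> m; have [] := bsY m.
Qed.

End bounded_lipschitz_functional.
End compound_process.

(** * Convergence of the compound Poisson processes *)

Unset Implicit Arguments.

Theorem corollary1 (R : realType) (d : measure_display) (T : measurableType d)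
  (P : probability T R)
  (xi_ : nat -> nat -> {RV P >-> R}) (xi : nat -> {RV P >-> R})
  (N : R -> T -> nat)
  (xi_n_iid : forall n, iid (xi_ n))
  (xi_iid : iid xi)
  (N_poisson : poisson_process P 1 N)
  (N_xi_n_independent : forall n, independent_classes P
     (sigma_generated [set t : R | 0 <= t] N)
     (sigma_generated [set: nat] (xi_ n)))
  (N_xi_independent : independent_classes P
     (sigma_generated [set t : R | 0 <= t] N)
     (sigma_generated [set: nat] xi))
  (xi_n_cvg : forall i, cvg_in_distribution P (fun n => xi_ n i) (xi i)) :
  cvg_in_distribution P
    (fun n w => compound_path (fun t => N t w) (poisson_cadlag N_poisson w)
                  (fun i => xi_ n i w))
    (fun w => compound_path (fun t => N t w) (poisson_cadlag N_poisson w)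
                (fun i => xi i w)).
Proof.
have mN := poisson_measurable N_poisson.
have mxi_ n i : measurable_fun setT (xi_ n i) by exact: measurable_funPT.
have mxi i : measurable_fun setT (xi i) by exact: measurable_funPT.
apply: cvg_in_distribution_lipschitz => [n||] h [M [L [L0 hM hL]]].
- by have [] := compound_process_bounded_measurable mN
    (poisson_cadlag N_poisson) L0 hM hL (mxi_ n).
- by have [] := compound_process_bounded_measurable mN
    (poisson_cadlag N_poisson) L0 hM hL mxi.
- have := @compound_process_cvg _ _ _ P N mN (poisson_cadlag N_poisson)
    h M L L0 hM hL (fun n i => xi_ n i) (fun i => xi i) mxi_ mxi.
  apply => //.
  + by move=> n; have [] := xi_n_iid n.
  + by have [] := xi_iid.
  + move=> i g cg [B gB].
    have bg (Z : T -> R) : measurable_fun setT Z -> bounded_measurable (g \o Z).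
      move=> mZ; split; last by exists B => w; exact: gB.
      by apply: measurableT_comp => //; exact: continuous_measurable_fun.
    have [_ _ /(_ g cg (ex_intro _ B gB))] := xi_n_cvg i.
    rewrite (expectationE _ (bg _ (mxi i))).
    under eq_cvg do rewrite (expectationE _ (bg _ (mxi_ _ i))).
    by move/fine_cvg.
Qed.
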